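(* Let $\Sigma_0$ be a Stäckel system on $S^{k-1}$ and let $\Sigma_\alpha$ be Stäckel systems on $S^{n_\alpha-1}$ for $\alpha=1,\dots,k$, all consisting of Killing tensors with diagonal algebraic curvature tensor. Then $$\Sigma_0\circ(\Sigma_1,\dots,\Sigma_k):=\iota_0(\Sigma_0)\oplus\iota_1(\Sigma_1)\oplus\dots\oplus\iota_k(\Sigma_k)$$ is a Stäckel system on $S^{n_1+\dots+n_k-1}$. Moreover, this operation together with the $S_n$-action $\sigma(K_{ij})=K_{\sigma(i)\sigma(j)}$, $\sigma\in S_n$, defines an operad structure on those Stäckel systems on $S^{n-1}$ that consist of Killing tensors with diagonal algebraic curvature tensor.
   Context: $S^{n-1}$ is the round unit sphere in $\mathbb R^n$ with its standard basis. A Killing tensor on a Riemannian manifold $M$ is $K\in\Gamma(S^2T^*M)$ with $\nabla_\alpha K_{\beta\gamma}+\nabla_\beta K_{\gamma\alpha}+\nabla_\gamma K_{\alpha\beta}=0$. Using the metric it is regarded as a field of endomorphisms of $TM$ (with the commutator bracket) and also as a function on $T^*M$ quadratic in the fibres (with the Poisson bracket). A Stäckel system on an $m$-dimensional Riemannian manifold is an $m$-dimensional space of Killing tensors which mutually commute with respect to both brackets; on $S^0$ there is only the empty Stäckel system. Killing tensors on $S^{n-1}$ are in linear bijection with algebraic curvature tensors $R$ on $\mathbb R^n$ (tensors with $R_{jikl}=-R_{ijkl}=R_{ijlk}$, $R_{klij}=R_{ijkl}$, $R_{ijkl}+R_{iklj}+R_{iljk}=0$) via $K_x(v,w)=\sum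 R_{ijkl}x^ix^kv^jw^l$; $R$ is diagonal if $R_{ijkl}=0$ unless $\{i,j\}=\{k,l\}$. Let $\mathfrak d_n^1$ be the space of Killing tensors on $S^{n-1}$ with diagonal algebraic curvature tensor. It has basis $K_{ij}$, $1\le i<j\le n$, where $K_{ij}=K_{ji}$ is the Killing tensor whose algebraic curvature tensor has $R_{ijij}=-R_{ijji}=R_{jiji}=-R_{jiij}=1$ and all other components zero. Let $I_1\cup\dots\cup I_k=I$ be a partition of $I=\{1,\dots,n\}$ with $|I_\alpha|=:n_\alpha$, so $n=n_1+\dots+n_k$, and set $I_0:=\{1,\dots,k\}$. Define injections $\iota_0:\mathfrak d_k^1\hookrightarrow\mathfrak d_{n_1+\dots+n_k}^1$ by $\iota_0(K_{\alpha\beta}):=\sum_{a\in I_\alpha,\,b\in I_\beta}K_{ab}$ for $\alpha,\beta\in I_0$ (distinct), and, for $\alpha=1,\dots,k$, $\iota_\alpha:\mathfrak d_{n_\alpha}^1\hookrightarrow\mathfrak d_{n_1+\dots+n_k}^1$ by $\iota_\alpha(K_{ij}):=K_{ij}$ for $i,j\in I_\alpha$ (distinct), where the coordinates of $\mathbb R^{n_\alpha}$ are indexed by $I_\alpha$. An operad structure on a sequence of objects $\mathcal O(n)$ is a composition map $\circ:\mathcal O(k)\times\mathcal O(n_1)\times\dots\times\mathcal O(n_k)\to\mathcal O(n_1+\dots+n_k)$, $(y,x_1,\dots,x_k)\mapsto y\circ(x_1,\dots,x_k)$, together with a right action $\star:\mathcal O(n)\times S_n\to\mathcal O(n)$, $(x,\pi)\mapsto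 x\star\pi$, of the permutation group $S_n$ on each $\mathcal O(n)$, satisfying the following axioms. Identity: there is a distinguished element $1\in\mathcal O(1)$ with $y\circ(1,\dots,1)=y=1\circ y$. Associativity: $z\circ(y_1\circ x_1,\dots,y_k\circ x_k)=\bigl(z\circ(y_1,\dots,y_k)\bigr)\circ(x_1,\dots,x_k)$, where here each $x_i$ stands for a tuple of the length required for composition with $y_i$. Equivariance: $(y\star\pi)\circ(x_1,\dots,x_k)=y\circ\bigl((x_1,\dots,x_k)\star\pi\bigr)$ and $y\circ(x_1\star\pi_1,\dots,x_k\star\pi_k)=\bigl(y\circ(x_1,\dots,x_k)\bigr)\star(\pi_1,\dots,\pi_k)$, where $S_k$ acts on $(x_1,\dots,x_k)$ by permutation and $(\pi_1,\dots,\pi_k)$ acts on $\mathcal O(n_1+\dots+n_k)$ under the inclusion $S_{n_1}\times\dots\times S_{n_k}\hookrightarrow S_{n_1+\dots+n_k}$. In the claim, $\mathcal O(n)$ is the set of Stäckel systems on $S^{n-1}$ consisting of Killing tensors with diagonal algebraic curvature tensor.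
   Formalization: The first equivariance axiom is stated in its standard form: the right side y∘((x_1,…,x_k)⋆π) is followed by the block permutation that puts the permuted blocks of coordinates back, since with consecutive blocks the printed equation fails (k=2, n=(1,2)). *)

(* Defs.v *)
From mathcomp Require Import all_boot all_order all_algebra all_fingroup.
From mathcomp Require Import all_classical all_reals all_analysis.
Import Order.TTheory GRing.Theory Num.Theory.
Import numFieldNormedType.Exports.

Set Implicit Arguments.
Unset Strict Implicit.
Unset Printing Implicit Defensive.

Local Open Scope classical_set_scope.
Local Open Scope ring_scope.

(* ** Tensor fields on the unit sphere of R^n *)

Definition dot (R : realType) n (u v : 'rV[R]_n) : R := \sum_i u 0 i * v 0 i.

(* The norm `|x| of the library on row vectors is the sup norm. *)
Definition enorm (R : realType) n (x : 'rV[R]_n) : R := Num.sqrt (dot x x).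

Definition sphere (R : realType) n := {x : 'rV[R]_n | dot x x == 1}.

(* Tangent spaces are T_s = s^\bot, and so are cotangent spaces, through the
   metric. *)
Definition tangent (R : realType) n (s : sphere R n) (v : 'rV[R]_n) : Prop :=
  dot (val s) v = 0.

(* A symmetric bilinear form on T_s, equivalently a symmetric endomorphism of
   T_s, is encoded by the unique symmetric n x n matrix A which represents it
   on T_s and kills the normal line: (v, w) |-> v A w^T and v |-> v A.
   Arbitrary elements of [tensor_field] carry no condition; [symmetric_tensor]
   selects the sections of S^2 T^*S. *)
Definition tensor_field (R : realType) n := sphere R n -> 'M[R]_n.

Definition symmetric_tensor (R : realType) n (K : tensor_field R n) : Prop :=
  forall s, (K s)^T = K s /\ val s *m K s = 0.

Fixpoint Ck (R : realType) n (k : nat) (f : 'rV[R]_n -> R) : Prop :=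
  if k is k'.+1 then
    forall v, (forall x, derivable f x v) /\ Ck k' (fun x => 'D_v f x)
  else continuous f.

Definition smooth (R : realType) n (f : 'rV[R]_n -> R) : Prop :=
  forall k, Ck k f.

(* The sphere is a closed submanifold: smooth means smoothly extendable. *)
Definition smooth_field (R : realType) n (K : tensor_field R n) : Prop :=
  exists F : 'rV[R]_n -> 'M[R]_n,
    (forall i j, smooth (fun x => F x i j)) /\ (forall s, K s = F (val s)).

(* The 0-homogeneous extension x |-> f (x / |x|), set to be 0 at 0. *)
Definition radial (R : realType) n (V : zmodType) (f : sphere R n -> V)
    (x : 'rV[R]_n) : V :=
  if insub ((enorm x)^-1 *: x) is Some s then f s else 0.

(* (nabla_u K)(v, w) at s for u, v, w in T_s.  Differentiate K(V, W) along u,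
   where V and W are the tangential projections of the constant fields v and w:
   the sphere covariant derivatives of V and W along u vanish at s and, as K
   kills normal vectors, K(V, W) = K(v, w). *)
Definition nabla (R : realType) n (K : tensor_field R n) (s : sphere R n)
    (u v w : 'rV[R]_n) : R :=
  'D_u (radial (fun y => (v *m K y *m w^T) 0 0)) (val s).

Definition killing (R : realType) n (K : tensor_field R n) : Prop :=
  [/\ symmetric_tensor K, smooth_field K &
      forall s u v w, tangent s u -> tangent s v -> tangent s w ->
        nabla K s u v w + nabla K s v w u + nabla K s w u v = 0].

(* ** The two brackets *)

Definition endo_commute (R : realType) n (K L : tensor_field R n) : Prop :=
  forall s, K s *m L s = L s *m K s.

(* Functions on T^*S are given by F s p, with p in T_s. *)
Definition quad (R : realType) n (K : tensor_field R n)
    (s : sphere R n) (p : 'rV[R]_n) : R := (p *m K s *m p^T) 0 0.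

(* Polar coordinates R^n \ 0 = S x R_{>0} give the symplectomorphism
   T^*(R^n \ 0) = T^*S x T^*R_{>0}, whose first component sends (x, p) to the
   point x / |x| with momentum |x| times the tangential part of p.  This is
   the pull-back of F along this component. *)
Definition cot_pullback (R : realType) n (F : sphere R n -> 'rV[R]_n -> R)
    (x p : 'rV[R]_n) : R :=
  radial (fun s => F s (enorm x *: (p - dot (val s) p *: val s))) x.

(* The Poisson bracket of T^*S at (s, p), computed as the canonical bracket of
   R^n x R^n on pull-backs, the above projection being a Poisson map. *)
Definition poisson (R : realType) n (F G : sphere R n -> 'rV[R]_n -> R)
    (s : sphere R n) (p : 'rV[R]_n) : R :=
  let dx H i := 'D_(delta_mx 0 i) (fun x => cot_pullback H x p) (val s) in
  let dp H i := 'D_(delta_mx 0 i) (fun q => cot_pullback H (val s) q) p in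
  \sum_(i < n) (dx F i * dp G i - dp F i * dx G i).

Definition poisson_commute (R : realType) n (K L : tensor_field R n) : Prop :=
  forall s p, tangent s p -> poisson (quad K) (quad L) s p = 0.

(* ** Staeckel systems *)

Definition has_dim (R : realType) (E : lmodType R) (V : set E) (m : nat) :
    Prop :=
  exists b : 'I_m -> E,
    (forall c : 'I_m -> R, \sum_i c i *: b i = 0 -> forall i, c i = 0) /\
    V = [set v | exists c : 'I_m -> R, v = \sum_i c i *: b i].

(* For n = 0 the sphere is empty and there is no Staeckel system. *)
Definition staeckel (R : realType) n (V : set (tensor_field R n)) : Prop :=
  [/\ (0 < n)%N,
      has_dim V n.-1,
      (forall K, V K -> killing K) &
      (forall K L, V K -> V L -> endo_commute K L /\ poisson_commute K L)].

(* ** Diagonal algebraic curvature tensors *)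

Definition tensor4 (R : realType) n := 'I_n -> 'I_n -> 'I_n -> 'I_n -> R.

Definition alg_curv (R : realType) n (C : tensor4 R n) : Prop :=
  forall i j k l,
    [/\ C j i k l = - C i j k l, C i j l k = - C i j k l,
        C k l i j = C i j k l & C i j k l + C i k l j + C i l j k = 0].

Definition diag_curv (R : realType) n (C : tensor4 R n) : Prop :=
  forall i j k l, ([set i; j] != [set k; l] :> {set 'I_n})%SET ->
    C i j k l = 0.

Definition curv_field (R : realType) n (C : tensor4 R n) : tensor_field R n :=
  fun s => \matrix_(j, l)
    \sum_i \sum_k C i j k l * val s 0 i * val s 0 k.

(* The space d^1_n. *)
Definition diag_killing (R : realType) n : set (tensor_field R n) :=
  [set K | killing K /\
     exists C : tensor4 R n, [/\ alg_curv C, diag_curv C & K = curv_field C]].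

Definition diag_staeckel (R : realType) n (V : set (tensor_field R n)) :
    Prop :=
  staeckel V /\ V `<=` @diag_killing R n.

(* For i != j the components are 1 at ijij and jiji, -1 at ijji and jiij. *)
Definition Kb_curv (R : realType) n (i j : 'I_n) : tensor4 R n :=
  fun a b c d =>
    ((a == i)%:R * (b == j)%:R - (a == j)%:R * (b == i)%:R) *
    ((c == i)%:R * (d == j)%:R - (c == j)%:R * (d == i)%:R).

Definition Kb (R : realType) n (i j : 'I_n) : tensor_field R n :=
  curv_field (@Kb_curv R n i j).

Arguments Kb R {n} i j.

Definition Kcomb (R : realType) n (E : lmodType R) (c : 'M[R]_n)
    (u : 'I_n -> 'I_n -> E) : E :=
  \sum_(i < n) \sum_(j < n | (i < j)%N) c i j *: u i j.

(* Coordinates of K in the basis K_ij, i < j, of d^1_n; only the entries above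
   the diagonal are meaningful. *)
Definition Kcoord (R : realType) n (K : tensor_field R n) : 'M[R]_n :=
  xget 0 [set c | K = Kcomb c (@Kb R n)].

(* The linear map on d^1_n which sends K_ij to u i j, for i < j. *)
Definition linext (R : realType) n (E : lmodType R) (u : 'I_n -> 'I_n -> E)
    (K : tensor_field R n) : E := Kcomb (Kcoord K) u.

(* ** Composition and symmetric group action *)

(* A partition of {1, ..., n} into blocks I_a of size n_ a, with an enumeration
   of each block, is a bijection e from the a-indexed disjoint union of the
   'I_(n_ a) onto 'I_n: the block I_a is the image of the summand a. *)
Definition iota0 (R : realType) k n (n_ : 'I_k -> nat)
    (e : {a : 'I_k & 'I_(n_ a)} -> 'I_n) :
    tensor_field R k -> tensor_field R n :=
  linext (fun a b => \sum_(i < n_ a) \sum_(j < n_ b)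
    Kb R (e (Tagged (fun a => 'I_(n_ a)) i))
         (e (Tagged (fun a => 'I_(n_ a)) j))).

Definition iota1 (R : realType) k n (n_ : 'I_k -> nat)
    (e : {a : 'I_k & 'I_(n_ a)} -> 'I_n) (a : 'I_k) :
    tensor_field R (n_ a) -> tensor_field R n :=
  linext (fun i j => Kb R (e (Tagged (fun a => 'I_(n_ a)) i))
                          (e (Tagged (fun a => 'I_(n_ a)) j))).

Definition sum_spaces (E : zmodType) k (V0 : set E) (V : 'I_k -> set E) :
    set E :=
  [set v | exists (v0 : E) (w : 'I_k -> E),
     [/\ V0 v0, forall a, V a (w a) & v = v0 + \sum_a w a]].

Definition direct_spaces (E : zmodType) k (V0 : set E) (V : 'I_k -> set E) :
    Prop :=
  forall (v0 : E) (w : 'I_k -> E), V0 v0 -> (forall a, V a (w a)) ->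
    v0 + \sum_a w a = 0 -> v0 = 0 /\ forall a, w a = 0.

Definition staeckel_comp (R : realType) k n (n_ : 'I_k -> nat)
    (e : {a : 'I_k & 'I_(n_ a)} -> 'I_n) (V0 : set (tensor_field R k))
    (V : forall a, set (tensor_field R (n_ a))) : set (tensor_field R n) :=
  sum_spaces (iota0 e @` V0) (fun a => iota1 e (a := a) @` V a).

Definition perm_act (R : realType) n (s : 'S_n) :
    tensor_field R n -> tensor_field R n :=
  linext (fun i j => Kb R (s i) (s j)).

(* ** Operads *)

(* 'I_(\sum_a n_ a) is split in consecutive blocks by tagnat.Rank, with inverse
   p |-> (tagnat.sig1 p, tagnat.sig2 p). *)

Lemma sum_perm k (n_ : 'I_k -> nat) (s : 'S_k) :
  (\sum_a n_ (s a))%N = (\sum_a n_ a)%N.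
Proof. by rewrite [RHS](reindex_inj (@perm_inj _ s)). Qed.

Definition block_fun k (n_ : 'I_k -> nat) (s : 'S_k)
    (p : 'I_(\sum_a n_ (s a))) : 'I_(\sum_a n_ (s a)) :=
  cast_ord (esym (sum_perm n_ s))
    (@tagnat.Rank k n_ (s (tagnat.sig1 p)) (tagnat.sig2 p)).

Lemma block_fun_inj k (n_ : 'I_k -> nat) (s : 'S_k) :
  injective (@block_fun k n_ s).
Proof.
move=> p q /cast_ord_inj /tagnat.rank_inj E.
apply: tagnat.sig_inj; rewrite !tagnat.sigE12.
move: (tagnat.sig1 p) (tagnat.sig2 p) (tagnat.sig1 q) (tagnat.sig2 q) E.
move=> a i b j E.
have /perm_inj ab := congr1 tag E; subst b.
by congr (Tagged _ _); move/eqP: E; rewrite eq_Tagged /= => /eqP.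
Qed.

(* The permutation which moves the blocks of sizes n_ (s 1), ..., n_ (s k) to
   the positions s 1, ..., s k they have among blocks of sizes
   n_ 1, ..., n_ k. *)
Definition block_perm k (n_ : 'I_k -> nat) (s : 'S_k) :
    'S_(\sum_a n_ (s a)) := perm (@block_fun_inj k n_ s).

Definition sum_perm_fun k (n_ : 'I_k -> nat) (s : forall a, 'S_(n_ a))
    (p : 'I_(\sum_a n_ a)) : 'I_(\sum_a n_ a) :=
  tagnat.Rank (tagnat.sig1 p) (s (tagnat.sig1 p) (tagnat.sig2 p)).

Lemma sum_perm_fun_inj k (n_ : 'I_k -> nat) (s : forall a, 'S_(n_ a)) :
  injective (sum_perm_fun s).
Proof.
move=> p q /tagnat.rank_inj E.
apply: tagnat.sig_inj; rewrite !tagnat.sigE12.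
move: (tagnat.sig1 p) (tagnat.sig2 p) (tagnat.sig1 q) (tagnat.sig2 q) E.
move=> a i b j E.
have /= ab := congr1 tag E; subst b.
by congr (Tagged _ _); move/eqP: E; rewrite eq_Tagged /= => /eqP /perm_inj.
Qed.

(* The inclusion of S_{n_1} x ... x S_{n_k} in S_{n_1 + ... + n_k}. *)
Definition sum_of_perms k (n_ : 'I_k -> nat) (s : forall a, 'S_(n_ a)) :
    'S_(\sum_a n_ a) := perm (@sum_perm_fun_inj k n_ s).

(* Equalities between O m and O n with m and n provably but not definitionally
   equal are stated in the total space {n & O n}.  Products of permutations are
   read from left to right: (s * t) i = t (s i). *)
Record operad (O : nat -> Type) := Operad {
  op_comp : forall k (n_ : 'I_k -> nat),
    O k -> (forall a, O (n_ a)) -> O (\sum_a n_ a)%N;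
  op_act : forall n, O n -> 'S_n -> O n;
  op_one : O 1%N;
  op_act1 : forall n (x : O n), op_act x 1%g = x;
  op_actM : forall n (x : O n) (s t : 'S_n),
    op_act x (s * t)%g = op_act (op_act x s) t;
  op_comp1r : forall k (y : O k),
    Tagged O (op_comp y (fun _ : 'I_k => op_one)) = Tagged O y;
  op_comp1l : forall n (y : O n),
    Tagged O (op_comp op_one (fun _ : 'I_1 => y)) = Tagged O y;
  op_compA : forall k (n_ : 'I_k -> nat) (m_ : forall a, 'I_(n_ a) -> nat)
      (z : O k) (y : forall a, O (n_ a)) (x : forall a i, O (m_ a i)),
    Tagged O (op_comp z (fun a => op_comp (y a) (x a))) =
    Tagged O (op_comp (op_comp z y)
      (fun p => x (tagnat.sig1 p) (tagnat.sig2 p)));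
  (* On the right the blocks carry their places with them: after composing, the
     permuted consecutive blocks are put back where they are on the left. *)
  op_equiv_outer : forall k (n_ : 'I_k -> nat) (y : O k)
      (x : forall a, O (n_ a)) (s : 'S_k),
    Tagged O (op_comp (op_act y s) x) =
    Tagged O (op_act (op_comp y (fun a => x (s a))) (block_perm n_ s));
  op_equiv_inner : forall k (n_ : 'I_k -> nat) (y : O k)
      (x : forall a, O (n_ a)) (s : forall a, 'S_(n_ a)),
    op_comp y (fun a => op_act (x a) (s a)) =
    op_act (op_comp y x) (sum_of_perms s)
}.

Definition DStaeckel (R : realType) (n : nat) : Type :=
  {V : set (tensor_field R n) | diag_staeckel V}.

(* Main.v *)
Require Import Defs.
From HB Require Import structures.
From mathcomp Require Import all_boot all_order all_algebra all_fingroup.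
From mathcomp Require Import all_classical all_reals all_analysis.
From mathcomp Require Import ring lra zify.
Import Order.TTheory GRing.Theory Num.Theory.
Import numFieldNormedType.Exports.

Set Implicit Arguments.
Unset Strict Implicit.
Unset Printing Implicit Defensive.

Local Open Scope classical_set_scope.
Local Open Scope ring_scope.

(* The idea: a Killing tensor sum_{i<j} c_ij K_ij is determined by its symmetric
   matrix c with zero diagonal, and two of them with matrices c and d commute
   for either bracket if and only if, for all indices a, b, m, the determinant
   with rows (1, 1, 1), (c_ab, c_am, c_bm) and (d_ab, d_am, d_bm) vanishes.
   The matrix of an element of the composition agrees with some c_alpha of
   Sigma_alpha on the block I_alpha, and is constant, with value (c_0)_alphabeta
   for some c_0 of Sigma_0, on I_alpha x I_beta for alpha <> beta.  For three
   indices in a same block, respectively in three different blocks, the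
   determinant vanishes because Sigma_alpha, respectively Sigma_0, is a
   Staeckel system; for two indices in one block and the third in another, two
   columns of the determinant agree.  The dimension is
   (k - 1) + sum (n_alpha - 1) = n - 1.  The operad axioms compare two
   descriptions of the same set of matrices. *)

(** * Dependent choice and sums over consecutive blocks *)

Lemma choice_dep (I : Type) (T : I -> Type) (P : forall i, T i -> Prop) :
  (forall i, exists x, P i x) -> exists f : forall i, T i, forall i, P i (f i).
Proof.
by move=> h; exists (fun i => sval (cid (h i))) => i; exact: (svalP (cid (h i))).
Qed.

Lemma big_tagnat (T : Type) (idx : T) (op : Monoid.com_law idx) k
    (m : 'I_k -> nat) (F : forall a, 'I_(m a) -> T) :
  \big[op/idx]_(p < (\sum_a m a)%N) F (tagnat.sig1 p) (tagnat.sig2 p) =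
  \big[op/idx]_a \big[op/idx]_i F a i.
Proof.
rewrite sig_big_dep /= (reindex (@tagnat.rank k m)) /=; last first.
  exact/onW_bij/tagnat.rank_bij.
apply: eq_bigr => t _; rewrite /tagnat.sig2 /tagnat.sig1.
by rewrite tagnat.rankK.
Qed.

(** Trades a pair (block, position) for the two components of a single flat index, on which
    [tagnat.sig2K] rewrites without transport between dependent types. *)
Lemma all_tagnat k (n_ : 'I_k -> nat) (P : forall a, 'I_(n_ a) -> Prop) :
  (forall p, P (tagnat.sig1 p) (tagnat.sig2 p)) -> forall a i, P a i.
Proof.
move=> H a i; pose P' (t : {a & 'I_(n_ a)}) := P (tag t) (tagged t).
by have := H (tagnat.Rank a i); rewrite -/(P' (tagnat.sig _)) tagnat.rankK.
Qed.

Lemma sum_lt_ord (F : nat -> nat) n (a : 'I_n) :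
  (\sum_(i < n | (i < a)%N) F i = \sum_(i < a) F i)%N.
Proof. by rewrite -(big_ord_widen n F (ltnW (ltn_ord a))). Qed.

(** Ranks order the pairs lexicographically, so the indices below (a, i) are those of the earlier
    blocks and the earlier ones of block a. With [F] giving block sizes, this compares the two
    numberings of nested blocks in the associativity law. *)
Lemma sum_lt_Rank k (n_ : 'I_k -> nat) (F : forall a, 'I_(n_ a) -> nat) a i :
  (\sum_(q < \sum_a n_ a | (q < @tagnat.Rank k n_ a i)%N)
     F (tagnat.sig1 q) (tagnat.sig2 q) =
   \sum_(b < k | (b < a)%N) \sum_j F b j + \sum_(j < n_ a | (j < i)%N) F a j)%N.
Proof.
have lt_Rank (b : 'I_k) (j : 'I_(n_ b)) :
    (@tagnat.Rank k n_ b j < @tagnat.Rank k n_ a i)%N =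
    (b < a)%N || (b == a) && (j < i)%N.
  have := @tagnat.lt_rank k n_ (Tagged _ j) (Tagged _ i).
  rewrite ltEord /= => ->; rewrite ltEsig /= !leEord.
  have [ba|ba|/val_inj ba] := ltngtP b a => //=.
    by rewrite -val_eqE /= gtn_eqF.
  by subst b; rewrite eqxx tagged_asE ltEord.
rewrite big_mkcond /=.
transitivity (\sum_b \sum_(j < n_ b)
    if (b < a)%N || (b == a) && (j < i)%N then F b j else 0)%N.
  rewrite -big_tagnat; apply: eq_bigr => q _.
  by rewrite -lt_Rank tagnat.sig2K.
rewrite (bigID (fun b : 'I_k => (b < a)%N)) /=; congr (_ + _)%N.
  by apply: eq_bigr => b ->.
rewrite (bigD1 a) ?ltnn //=.
rewrite [X in (_ + X)%N]big1 => [|b /andP [/negPf ba /negPf na]].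
  rewrite addn0 [RHS]big_mkcond; apply: eq_bigr => j _.
  by rewrite eqxx.
by rewrite big1 // => j _; rewrite ba na.
Qed.

Lemma sum_delta (R : pzRingType) n (F : 'I_n -> R) (k : 'I_n) :
  \sum_a (a == k)%:R * F a = F k.
Proof.
rewrite (bigD1 k) //= eqxx mul1r big1 ?addr0 // => a /negPf ->.
by rewrite mul0r.
Qed.

(** * Diagonal Killing tensors as matrices *)

Section MatrixFields.
Variables (R : realType) (n : nat).
Implicit Types (c d : 'M[R]_n) (s : sphere R n).

Definition sym0 c := c^T = c /\ forall i, c i i = 0.

Lemma sym0C c i j : sym0 c -> c i j = c j i.
Proof. by case=> cT _; rewrite -{1}cT mxE. Qed.

Lemma sym0_lin (a : R) c d : sym0 c -> sym0 d -> sym0 (a *: c + d).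
Proof.
move=> [cT c0] [dT d0]; split; first by rewrite linearP /= cT dT.
by move=> i; rewrite !mxE c0 d0 mulr0 addr0.
Qed.

Lemma sym00 : sym0 0.
Proof. by split; [rewrite trmx0|move=> i; rewrite mxE]. Qed.

Lemma sym0_sum (I : finType) (x : I -> R) (c : I -> 'M[R]_n) :
  (forall i, sym0 (c i)) -> sym0 (\sum_i x i *: c i).
Proof.
move=> cs; apply: big_rec => [|i y _ ys]; first exact: sym00.
exact: sym0_lin.
Qed.

(* The extension of sum_{i<j} c_ij K_ij to R^n, homogeneous of degree 2; the
   diagonal of c cancels out. *)
Definition Kmx_fun c (x : 'rV[R]_n) : 'M[R]_n :=
  \matrix_(p, q) ((p == q)%:R * (\sum_r c p r * x 0 r ^+ 2)
                  - c p q * x 0 p * x 0 q).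

Definition Kmx c : tensor_field R n := fun s => Kmx_fun c (val s).

Lemma Kmx_fun_lin (a : R) c d x :
  Kmx_fun (a *: c + d) x = a *: Kmx_fun c x + Kmx_fun d x.
Proof.
apply/matrixP => p q; rewrite !mxE.
have -> : \sum_r (a *: c + d) p r * x 0 r ^+ 2 =
    a * (\sum_r c p r * x 0 r ^+ 2) + \sum_r d p r * x 0 r ^+ 2.
  rewrite mulr_sumr -big_split; apply: eq_bigr => r _ /=.
  by rewrite !mxE mulrDl mulrA.
ring.
Qed.

Lemma Kmx_is_linear : linear Kmx.
Proof. by move=> a c d; apply/funext => s; exact: Kmx_fun_lin. Qed.
HB.instance Definition _ :=
  GRing.isLinear.Build R 'M[R]_n (tensor_field R n) _ Kmx Kmx_is_linear.

Lemma Kmx0 : Kmx 0 = 0.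
Proof. exact: linear0. Qed.

Lemma KmxD c d : Kmx (c + d) = Kmx c + Kmx d.
Proof. exact: linearD. Qed.

Lemma KmxB c d : Kmx (c - d) = Kmx c - Kmx d.
Proof. exact: linearB. Qed.

Lemma KmxZ (a : R) c : Kmx (a *: c) = a *: Kmx c.
Proof. exact: linearZ. Qed.

Lemma Kmx_sum (I : finType) (c : I -> 'M[R]_n) :
  Kmx (\sum_i c i) = \sum_i Kmx (c i).
Proof. exact: linear_sum. Qed.

(** The case i = j is included: the curvature tensor is then 0, and diagonal entries cancel in
    [Kmx]. This allows sums over all pairs later on. *)
Lemma Kb_Kmx (i j : 'I_n) : Kb R i j = Kmx (delta_mx i j + delta_mx j i).
Proof.
apply/funext => s; apply/matrixP => p q; rewrite !mxE /Kb_curv.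
set x := val s.
have pick := @sum_delta R n.
have -> : \sum_r (delta_mx i j + delta_mx j i : 'M[R]_n) p r * x 0 r ^+ 2 =
    (p == i)%:R * x 0 j ^+ 2 + (p == j)%:R * x 0 i ^+ 2.
  rewrite -(pick (fun r => (p == i)%:R * x 0 r ^+ 2)).
  rewrite -(pick (fun r => (p == j)%:R * x 0 r ^+ 2)) -big_split /=.
  by apply: eq_bigr => r _; rewrite !mxE -!mulnb !natrM; ring.
(* The curvature tensor of K_ij is a product of two 2-forms, so the double sum over the coordinates
   of x factors. *)
under eq_bigr => a _.
  have -> : \sum_k ((a == i)%:R * (p == j)%:R - (a == j)%:R * (p == i)%:R) *
     ((k == i)%:R * (q == j)%:R - (k == j)%:R * (q == i)%:R) * x 0 a * x 0 k =
   ((a == i)%:R * ((p == j)%:R * x 0 a) - (a == j)%:R * ((p == i)%:R * x 0 a)) *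
     ((q == j)%:R * x 0 i - (q == i)%:R * x 0 j).
    rewrite -(pick (fun k => (q == j)%:R * x 0 k)).
    rewrite -(pick (fun k => (q == i)%:R * x 0 k)) -sumrB mulr_sumr.
    by apply: eq_bigr => k _; ring.
  over.
rewrite -mulr_suml sumrB !pick -!mulnb !natrM.
have [->|npq] := eqVneq p q.
  do 2 case: eqVneq => ? //=; rewrite ?mulr0 ?mulr1; subst; ring.
rewrite mul0r.
have [pi|pi] := eqVneq p i; have [pj|pj] := eqVneq p j;
have [qi|qi] := eqVneq q i; have [qj|qj] := eqVneq q j => /=;
 subst; rewrite ?eqxx in npq *; try by []; ring.
Qed.
End MatrixFields.

(** * Homogeneity, coordinates in the basis K_ij, and diagonal curvature tensors *)

Section Normalization.
Variables (R : realType) (n : nat).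
Implicit Types (c d : 'M[R]_n) (s : sphere R n) (x : 'rV[R]_n).

Lemma dot_ge0 x : 0 <= dot x x.
Proof. by apply: sumr_ge0 => i _; rewrite -expr2 sqr_ge0. Qed.

Lemma dotZ (a : R) x : dot (a *: x) (a *: x) = a ^+ 2 * dot x x.
Proof.
by rewrite /dot mulr_sumr; apply: eq_bigr => i _; rewrite !mxE; ring.
Qed.

Lemma enorm_sqr x : enorm x ^+ 2 = dot x x.
Proof. by rewrite sqr_sqrtr ?dot_ge0. Qed.

Lemma dot_eq0 x : (dot x x == 0) = (x == 0).
Proof.
apply/idP/eqP => [|->]; last by rewrite /dot big1 // => i _; rewrite mxE mul0r.
rewrite psumr_eq0; last by move=> i _; rewrite -expr2 sqr_ge0.
move=> /allP x0; apply/rowP => i; rewrite mxE.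
by have := x0 i (mem_index_enum _); rewrite mulf_eq0 orbb => /eqP.
Qed.

Lemma enorm_eq0 x : (enorm x == 0) = (x == 0).
Proof. by rewrite -dot_eq0 -enorm_sqr sqrf_eq0. Qed.

Lemma normalizedP x : x != 0 -> dot ((enorm x)^-1 *: x) ((enorm x)^-1 *: x) == 1.
Proof.
move=> x0; rewrite dotZ -enorm_sqr -exprMn mulVf ?expr1n //.
by rewrite enorm_eq0.
Qed.

Lemma radialE (V : zmodType) (f : sphere R n -> V) x : x != 0 ->
  exists2 s, val s = (enorm x)^-1 *: x & radial f x = f s.
Proof.
move=> /normalizedP x1; exists (Sub ((enorm x)^-1 *: x) x1) => //.
by rewrite /radial insubT.
Qed.

Lemma radial0 (V : zmodType) (f : sphere R n -> V) : radial f 0 = 0.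
Proof.
rewrite /radial insubF // scaler0 /dot big1 ?[0 == 1]eq_sym ?oner_eq0 //.
by move=> i _; rewrite mxE mul0r.
Qed.

Lemma Kmx_funZ c (a : R) x : Kmx_fun c (a *: x) = a ^+ 2 *: Kmx_fun c x.
Proof.
apply/matrixP => p q; rewrite !mxE.
have -> : \sum_r c p r * (a *: x) 0 r ^+ 2 = a ^+ 2 * \sum_r c p r * x 0 r ^+ 2.
  by rewrite mulr_sumr; apply: eq_bigr => r _; rewrite !mxE; ring.
ring.
Qed.

(** By homogeneity, identities between fields on the sphere can be tested at any nonzero vector, in
    particular at 0/1 vectors. The point [s] is the same for all [c], so that several fields can be
    compared there. *)
Lemma Kmx_fun_sphere x : x != 0 ->
  exists s, forall c, Kmx_fun c x = enorm x ^+ 2 *: Kmx c s.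
Proof.
move=> x0; exists (Sub ((enorm x)^-1 *: x) (normalizedP x0)) => c.
by rewrite /Kmx Kmx_funZ scalerA -exprMn mulfV ?enorm_eq0 // expr1n scale1r.
Qed.

(** At a vector whose coordinates i and j are 1, the off-diagonal entry (i, j) of the field is - c i
    j. *)
Lemma Kmx_eq0 c : Kmx c = 0 -> forall i j, i != j -> c i j = 0.
Proof.
move=> c0 i j ij.
have [x [xi xj]] : exists x : 'rV[R]_n, x 0 i = 1 /\ x 0 j = 1.
  exists (delta_mx 0 i + delta_mx 0 j).
  by rewrite !mxE !eqxx /= (negPf ij) eq_sym (negPf ij) addr0 add0r.
have x0 : x != 0.
  by apply/eqP => /rowP /(_ i); rewrite xi mxE => /eqP; rewrite oner_eq0.
have [s Es] := Kmx_fun_sphere x0.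
have := congr1 (fun A : 'M[R]_n => A i j) (Es c).
rewrite c0 !mxE (negPf ij) xi xj mul0r sub0r !mulr1 mulr0 => /eqP.
by rewrite oppr_eq0 => /eqP.
Qed.

Lemma Kmx_inj c d : sym0 c -> sym0 d -> Kmx c = Kmx d -> c = d.
Proof.
move=> [_ c0] [_ d0] cd; apply/matrixP => i j.
have [->|ij] := eqVneq i j; first by rewrite c0 d0.
have /Kmx_eq0 /(_ i j ij) : Kmx (c - d) = 0 by rewrite KmxB cd subrr.
by rewrite !mxE => /eqP; rewrite subr_eq0 => /eqP.
Qed.

Lemma Kcomb_ext (E : lmodType R) c d (u : 'I_n -> 'I_n -> E) :
  (forall i j : 'I_n, (i < j)%N -> c i j = d i j) -> Kcomb c u = Kcomb d u.
Proof.
by move=> cd; apply: eq_bigr => i _; apply: eq_bigr => j ij; rewrite cd.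
Qed.

Lemma Kcomb_sum (E : lmodType R) c (w : 'I_n -> 'I_n -> E) : sym0 c ->
  Kcomb c (fun i j => w i j + w j i) = \sum_i \sum_j c i j *: w i j.
Proof.
move=> cs; transitivity (\sum_(i < n) (\sum_(j < n | (i < j)%N) c i j *: w i j
   + \sum_(j < n | (j < i)%N) c i j *: w i j)).
  rewrite big_split /= [X in _ = _ + X]pair_big_dep /=.
  rewrite [X in _ = _ + X](reindex_inj (h := fun p => (p.2, p.1))) /=; last first.
    by move=> [? ?] [? ?] /= [-> ->].
  rewrite -(pair_big_dep xpredT (fun i j : 'I_n => (i < j)%N)
     (fun i j => c j i *: w j i)) /= -big_split /=.
  apply: eq_bigr => i _; rewrite -big_split /=; apply: eq_bigr => j _.
  by rewrite scalerDr (sym0C j i cs).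
apply: eq_bigr => i _; rewrite [RHS](bigID (fun j : 'I_n => (i < j)%N)) /=.
congr (_ + _); rewrite [RHS](bigD1 i) /= ?ltnn // cs.2 scale0r add0r.
by apply: eq_bigl => j; rewrite -leqNgt ltn_neqAle andbC.
Qed.

(** [Kcoord] returns some matrix of coordinates whose entries on and below the diagonal are
    arbitrary; this is the representative in [sym0] with the same entries above the diagonal. *)
Definition upper_sym c : 'M[R]_n :=
  \matrix_(i, j) if (i < j)%N then c i j else if (j < i)%N then c j i else 0.

Lemma upper_sym_sym0 c : sym0 (upper_sym c).
Proof.
split=> [|i]; last by rewrite mxE ltnn.
by apply/matrixP => i j; rewrite !mxE; case: ltngtP.
Qed.

Lemma Kcomb_Kb c : sym0 c -> Kcomb c (@Kb R n) = Kmx c.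
Proof.
move=> cs; transitivity
  (Kcomb c (fun i j => Kmx (delta_mx i j) + Kmx (delta_mx j i))).
  by apply: eq_bigr => i _; apply: eq_bigr => j _; rewrite Kb_Kmx linearD.
rewrite (Kcomb_sum (fun i j => Kmx (delta_mx i j)) cs).
rewrite [in RHS](matrix_sum_delta c) Kmx_sum; apply: eq_bigr => i _.
by rewrite Kmx_sum; apply: eq_bigr => j _; rewrite KmxZ.
Qed.

(** The coordinates chosen by [Kcoord], once symmetrized, are [c] itself, because [Kmx] is injective
    on [sym0]. Splitting [u] as a symmetrization of [w] turns the sum over i < j into one over all
    ordered pairs, on which linearity is easier to use. *)
Lemma linext_Kmx (E : lmodType R) (u w : 'I_n -> 'I_n -> E) c : sym0 c ->
  (forall i j, u i j = w i j + w j i) ->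
  linext u (Kmx c) = \sum_i \sum_j c i j *: w i j.
Proof.
move=> cs uw; rewrite -(Kcomb_sum _ cs) /linext /Kcoord.
(* The default value of [xget] does not occur, since [c] itself is a matrix of coordinates. *)
case: xgetP => [c' _ /= Ec|/(_ c)]; last by rewrite /= Kcomb_Kb.
rewrite (_ : Kcomb c' _ = Kcomb (upper_sym c') (@Kb R n)) in Ec; last first.
  by apply: Kcomb_ext => i j ij; rewrite mxE ij.
rewrite (Kcomb_Kb (upper_sym_sym0 c')) in Ec.
have {Ec} -> := Kmx_inj cs (upper_sym_sym0 c') Ec.
transitivity (Kcomb (upper_sym c') u).
  by apply: Kcomb_ext => i j ij; rewrite mxE ij.
by apply: eq_bigr => i _; apply: eq_bigr => j _; rewrite uw.
Qed.

(** By the skew symmetries, a diagonal curvature tensor is determined by its sectional components C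
    i j i j. On the diagonal of the field only the terms with i = k remain. *)
Lemma curv_Kmx (C : tensor4 R n) : alg_curv C -> diag_curv C ->
  let c := \matrix_(i, j) C i j i j in sym0 c /\ curv_field C = Kmx c.
Proof.
move=> Ca Cd c.
have cE i j : c i j = C i j i j by rewrite mxE. clearbody c.
have C0 i k l : C i i k l = 0.
  by have [] := Ca i i k l => ? _ _ _; lra.
have Cz i j k l : [set i; j]%SET != [set k; l]%SET -> C i j k l = 0 by exact: Cd.
split.
  split=> [|i]; last by rewrite cE C0.
  apply/matrixP => i j; rewrite mxE !cE.
  by have [-> _ _ _] := Ca i j j i; have [_ -> _ _] := Ca i j i j; rewrite opprK.
apply/funext => s; apply/matrixP => j l; rewrite !mxE; set x := val s.
have [<-|jl] := eqVneq j l.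
  rewrite mul1r cE C0 !mul0r subr0; apply: eq_bigr => i _.
  rewrite (bigD1 i) //= big1 ?addr0 => [|k ki].
    by rewrite cE; have [-> _ _ _] := Ca j i i j;
       have [_ -> _ _] := Ca j i j i; ring.
  rewrite Cz ?mul0r //; apply/eqP => /setP E.
  have := E i; have := E k; rewrite !inE !eqxx (eq_sym i k) (negPf ki).
  by move=> /= /eqP <-; rewrite eq_sym (negPf ki).
(* Off the diagonal of the field, the only component that survives is C l j j l. *)
rewrite mul0r sub0r (bigD1 l) //= (bigD1 j) //= !big1 ?addr0.
- by rewrite cE; have [-> _ _ _] := Ca j l j l; ring.
- move=> i il; rewrite big1 // => k _.
  rewrite Cz ?mul0r //; apply/eqP => /setP E.
  have := E l; rewrite !inE !eqxx orbT eq_sym (negPf il) /= eq_sym.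
  by rewrite (negPf jl).
move=> k kj; have [Elk|nkl] := eqVneq k l.
  have [_ CE _ _] := Ca l j k k; rewrite Elk in CE *.
  by rewrite (_ : C l j l l = 0) ?mul0r //; lra.
rewrite Cz ?mul0r //; apply/eqP => /setP E.
by have := E k; rewrite !inE !eqxx /= (negPf kj) (negPf nkl).
Qed.

Lemma Kmx_curv c : sym0 c ->
  exists C : tensor4 R n, [/\ alg_curv C, diag_curv C & Kmx c = curv_field C].
Proof.
(* The curvature tensor of constant curvature 1, with the components on the plane of i and j scaled
   by c i j. *)
move=> cs; pose C : tensor4 R n := fun i j k l => c i j *
  ((i == k)%:R * (j == l)%:R - (i == l)%:R * (j == k)%:R).
have Ca : alg_curv C.
  move=> i j k l; rewrite /C; split.
  - by rewrite (sym0C j i cs); ring.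
  - ring.
  - rewrite !(eq_sym k) !(eq_sym l).
    have [ik|_] := eqVneq i k; have [jl|_] := eqVneq j l;
    have [il|_] := eqVneq i l; have [jk|_] := eqVneq j k; subst;
    first [ring | rewrite (sym0C _ _ cs) /=; ring].
  - rewrite (eq_sym k j) (eq_sym l k) (eq_sym l j).
    have [<-|/negPf jl] := eqVneq j l; have [<-|/negPf jk] := eqVneq j k;
    rewrite ?eqxx ?jl ?jk /=; try ring.
    by have [<-|_] := eqVneq k l; rewrite /=; ring.
have Cd : diag_curv C.
  move=> i j k l kl; rewrite /C -!natrM !mulnb.
  have -> : (i == k) && (j == l) = false.
    by apply: contraNF kl => /andP [/eqP -> /eqP ->].
  have -> : (i == l) && (j == k) = false.
    by apply: contraNF kl => /andP [/eqP -> /eqP ->]; rewrite finset.setUC.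
  by rewrite subrr mulr0.
exists C; split=> //; rewrite (curv_Kmx Ca Cd).2; congr Kmx.
apply/matrixP => i j; rewrite mxE /C !eqxx.
have [->|/negPf ij] := eqVneq i j; first by rewrite cs.2 mul0r.
by rewrite /= mul0r subr0 !mulr1.
Qed.
End Normalization.

(** * The Killing equation and the two brackets *)

Section PolynomialFunctions.
Variables (R : realType) (n : nat).

(** This class is stable under directional derivatives and consists of continuous functions, whence
    smoothness by induction on the order. *)
Inductive polyfun : ('rV[R]_n -> R) -> Prop :=
| PolyCst a : polyfun (fun=> a)
| PolyCoord i : polyfun (fun x => x 0 i)
| PolyAdd f g : polyfun f -> polyfun g -> polyfun (fun x => f x + g x)
| PolyMul f g : polyfun f -> polyfun g -> polyfun (fun x => f x * g x).

Lemma polyfun_sum (I : finType) (F : I -> 'rV[R]_n -> R) :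
  (forall i, polyfun (F i)) -> polyfun (fun x => \sum_i F i x).
Proof.
move=> PF; elim: (index_enum I) => [|i r IH].
  under eq_fun do rewrite big_nil; exact: PolyCst.
under eq_fun do rewrite big_cons; exact: PolyAdd (PF i) IH.
Qed.

Lemma polyfun_continuous f : polyfun f -> continuous f.
Proof.
elim=> [a|i|{}f g _ fc _ gc|{}f g _ fc _ gc] x.
- exact: cst_continuous.
- exact: coord_continuous.
- exact: cvgD (fc x) (gc x).
- exact: cvgM (fc x) (gc x).
Qed.

Lemma polyfun_derive f : polyfun f -> forall v,
  (forall x, derivable f x v) /\ polyfun (fun x => 'D_v f x).
Proof.
elim=> [a|i|{}f g Pf IHf Pg IHg|{}f g Pf IHf Pg IHg] v.
- split=> [x|]; first exact: derivable_cst.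
  by under eq_fun do rewrite derive_cst; exact: PolyCst.
- have dc x : is_derive x v (fun x : 'rV[R]_n => x 0 i) (v 0 i).
    have did : derivable (id : 'rV[R]_n -> _) x v by exact: derivable_id.
    apply: DeriveDef; first exact: ((derivable_mxP _ _ _).1 did).
    by have := derive_mx did; rewrite derive_id => {2}->; rewrite mxE.
  split=> [x|]; first by have [] := dc x.
  by under eq_fun => x do rewrite (@derive_val _ _ _ _ _ _ _ (dc x)); exact: PolyCst.
- have [df Pdf] := IHf v; have [dg Pdg] := IHg v; split=> [x|].
    exact: derivableD.
  by under eq_fun do rewrite deriveD//; exact: PolyAdd Pdf Pdg.
- have [df Pdf] := IHf v; have [dg Pdg] := IHg v; split=> [x|].
    exact: derivableM.
  under eq_fun do rewrite deriveM//.
  exact: PolyAdd (PolyMul Pf Pdg) (PolyMul Pg Pdf).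
Qed.

Lemma polyfun_smooth f : polyfun f -> smooth f.
Proof.
move=> + k; elim: k f => [|k IH] f Pf; first exact: polyfun_continuous.
by move=> v; have [df /IH] := polyfun_derive Pf v.
Qed.

(** Each derivative needed for [nabla] and the Poisson bracket is along a line on which the function
    is quadratic in h, possibly divided by a squared norm 1 + nu h^2. This denominator has no linear
    term, so the derivative at h = 0 is the linear coefficient of the numerator. *)
Lemma derive_line (f : 'rV[R]_n -> R) x u (q0 q1 q2 nu : R) : 0 <= nu ->
  (forall h, f (h *: u + x) = (q0 + q1 * h + q2 * h ^+ 2) / (1 + nu * h ^+ 2)) ->
  'D_u f x = q1.
Proof.
move=> nu0 fE.
have den h : 1 + nu * h ^+ 2 != 0.
  by apply: lt0r_neq0; rewrite ltr_wpDr // mulr_ge0 // sqr_ge0.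
(* The difference quotient after cancelling h, which extends continuously to h = 0. *)
pose phi h := (q1 + (q2 - q0 * nu) * h) * (1 + nu * (h * h))^-1.
have phi0 : phi @ 0^' --> phi 0.
  apply: cvg_trans (_ : phi @ nbhs 0 --> _).
    exact: cvg_within_filter.
  have hid : (fun h : R => h) @ nbhs 0 --> (0 : R) by exact: cvg_id.
  apply: cvgM.
    by apply: cvgD; [exact: cvg_cst|apply: cvgM => //; exact: cvg_cst].
  apply: cvgV; first by rewrite -expr2 den.
  apply: cvgD; first exact: cvg_cst.
  by apply: cvgM; [exact: cvg_cst|exact: cvgM].
have <- : phi 0 = q1 by rewrite /phi !mulr0 !addr0 invr1 mulr1.
apply: cvg_lim => //; apply: cvg_trans phi0; apply: near_eq_cvg.
near=> h.
have h0 : h != 0 by near: h; exact: nbhs_dnbhs_neq.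
rewrite /= fE /phi -expr2.
have := fE 0; rewrite scale0r add0r => ->.
have d := den h.
by rewrite /GRing.scale /=; field; rewrite d h0.
Unshelve. all: by end_near. Qed.

End PolynomialFunctions.

(** * Killing equation, commutator and Poisson bracket of the fields [Kmx c] *)

Section Commutation.
Variables (R : realType) (n : nat).
Implicit Types (c d : 'M[R]_n) (s : sphere R n) (u v w x p : 'rV[R]_n).

Lemma Kmx_symmetric c : sym0 c -> symmetric_tensor (Kmx c).
Proof.
move=> cs s; split.
  apply/matrixP => p q; rewrite !mxE (sym0C q p cs) [q == p]eq_sym.
  by have [->|_] := eqVneq p q; rewrite /= ?mul0r; ring.
apply/rowP => q; rewrite !mxE.
set x := val s.
under eq_bigr do rewrite !mxE mulrBr.
rewrite sumrB (bigD1 q) //= eqxx.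
rewrite [X in _ + X - _]big1 => [|p /negPf ->]; last first.
  by rewrite /= mul0r mulr0.
rewrite addr0 mul1r mulr_sumr -sumrB big1 // => p _.
by rewrite (sym0C q p cs); ring.
Qed.

Lemma Kmx_smooth c : smooth_field (Kmx c).
Proof.
exists (Kmx_fun c); split=> // p q; apply: polyfun_smooth.
have -> : (fun x => Kmx_fun c x p q) = (fun x : 'rV[R]_n =>
    (p == q)%:R * (\sum_r c p r * (x 0 r * x 0 r)) + (- c p q * x 0 p) * x 0 q).
  apply/funext => x; rewrite mxE mulNr mulNr; congr (_ * _ - _).
do ![apply: PolyAdd|apply: PolyMul|apply: PolyCst|apply: PolyCoord].
apply: polyfun_sum => r.
by do ![apply: PolyAdd|apply: PolyMul|apply: PolyCst|apply: PolyCoord].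
Qed.

(** The Plücker coordinates of the 2-vector spanned by v and x; for a momentum v at the point x they
    are, up to sign, the angular momenta. *)
Definition wedge v x (a b : 'I_n) : R := v 0 a * x 0 b - v 0 b * x 0 a.

(* The polarization of the quadratic form sum_{a<b} c_ab G_ab^2. *)
Definition pairing c (F G : 'I_n -> 'I_n -> R) : R :=
  2^-1 * \sum_a \sum_b c a b * (F a b * G a b).

(** Averaging the double sum with its transpose completes each term to a product of two wedges:
    diagonal Killing tensors are combinations of squares of angular momenta. *)
Lemma Kmx_fun_form c v w x : sym0 c ->
  (v *m Kmx_fun c x *m w^T) 0 0 = pairing c (wedge v x) (wedge w x).
Proof.
move=> cs.
pose g a b := c a b * (v 0 a * w 0 a * x 0 b ^+ 2 - v 0 a * w 0 b * x 0 a * x 0 b).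
have -> : (v *m Kmx_fun c x *m w^T) 0 0 = \sum_a \sum_b g a b.
  rewrite -mulmxA mxE; apply: eq_bigr => a _; rewrite mxE.
  under eq_bigr do rewrite !mxE mulrBl.
  rewrite sumrB (bigD1 a) //= eqxx [X in _ + X - _]big1 => [|b ba]; last first.
    by rewrite eq_sym (negPf ba) /= !mul0r.
  rewrite addr0 mul1r mulr_suml -sumrB mulr_sumr; apply: eq_bigr => b _.
  by rewrite /g; ring.
have gT : \sum_a \sum_b g a b = \sum_a \sum_b g b a by exact: exchange_big.
have -> : \sum_a \sum_b g a b = 2^-1 * (\sum_a \sum_b g a b + \sum_a \sum_b g b a).
  by rewrite -gT; field.
rewrite /pairing -big_split; congr (_ * _); apply: eq_bigr => a _ /=.
rewrite -big_split; apply: eq_bigr => b _ /=.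
by rewrite /g /wedge (sym0C b a cs); ring.
Qed.

Lemma wedge_line u v x (h : R) a b :
  wedge v (h *: u + x) a b = wedge v x a b + h * wedge v u a b.
Proof. by rewrite /wedge !mxE; ring. Qed.

Lemma pairing_line c (F F' G G' : 'I_n -> 'I_n -> R) (h : R) :
  pairing c (fun a b => F a b + h * F' a b) (fun a b => G a b + h * G' a b) =
  pairing c F G + (pairing c F G' + pairing c F' G) * h + pairing c F' G' * h ^+ 2.
Proof.
transitivity (2^-1 * (\sum_a \sum_b c a b * (F a b * G a b) +
    (\sum_a \sum_b c a b * (F a b * G' a b) +
     \sum_a \sum_b c a b * (F' a b * G a b)) * h +
    (\sum_a \sum_b c a b * (F' a b * G' a b)) * h ^+ 2)); last first.
  by rewrite /pairing; ring.
congr (_ * _); rewrite -big_split !mulr_suml -!big_split.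
apply: eq_bigr => a _ /=; rewrite -big_split !mulr_suml -!big_split.
by apply: eq_bigr => b _ /=; ring.
Qed.

Lemma pairing_ext c (F F' G G' : 'I_n -> 'I_n -> R) :
  (forall a b, F a b = F' a b) -> (forall a b, G a b = G' a b) ->
  pairing c F G = pairing c F' G'.
Proof.
move=> FE GE; congr (_ * _); apply: eq_bigr => a _.
by apply: eq_bigr => b _; rewrite FE GE.
Qed.

(** For u tangent at s, the squared norm of s + h u is 1 + |u|^2 h^2 and the wedges are affine in h,
    so [derive_line] reads off the linear coefficient of the pairing. *)
Lemma nabla_Kmx c s u v w : sym0 c -> tangent s u ->
  nabla (Kmx c) s u v w =
  pairing c (wedge v (val s)) (wedge w u) + pairing c (wedge v u) (wedge w (val s)).
Proof.
move=> cs us; rewrite /nabla.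
apply: (derive_line (q0 := pairing c (wedge v (val s)) (wedge w (val s)))
  (q2 := pairing c (wedge v u) (wedge w u)) (dot_ge0 u)) => h.
set x := h *: u + val s.
have xx : dot x x = 1 + dot u u * h ^+ 2.
  transitivity (dot (val s) (val s) + 2 * h * dot (val s) u + dot u u * h ^+ 2).
    rewrite /dot mulr_sumr mulr_suml -!big_split; apply: eq_bigr => i _ /=.
    by rewrite !mxE; ring.
  by rewrite (eqP (valP s)) us mulr0 addr0.
have x0 : x != 0.
  rewrite -dot_eq0 xx lt0r_neq0 // ltr_wpDr // mulr_ge0 ?dot_ge0 //.
  exact: sqr_ge0.
have [t tx ->] := radialE (fun y => (v *m Kmx c y *m w^T) 0 0) x0.
rewrite /Kmx tx Kmx_funZ -scalemxAr -scalemxAl mxE Kmx_fun_form //.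
rewrite exprVn enorm_sqr xx mulrC; congr (_ / _).
rewrite -pairing_line; apply: pairing_ext => a b; exact: wedge_line.
Qed.

(** In the cyclic sum the six products of wedges cancel in pairs, already for fixed a and b, because
    the wedge is antisymmetric in its two vectors. *)
Lemma Kmx_killing c : sym0 c -> killing (Kmx c).
Proof.
move=> cs; split; [exact: Kmx_symmetric|exact: Kmx_smooth|].
move=> s u v w us vs ws; rewrite !nabla_Kmx // /pairing -!mulrDr.
apply/eqP; rewrite mulf_eq0; apply/orP; right; apply/eqP.
rewrite -!big_split big1 // => a _ /=; rewrite -!big_split big1 // => b _ /=.
by rewrite /wedge; ring.
Qed.

(* The determinant with rows (1, 1, 1), (c_ab, c_am, c_bm), (d_ab, d_am, d_bm),
   up to sign. *)
Definition Delta c d (a b m : 'I_n) : R :=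
  c a b * (d a m - d b m) + c a m * (d b m - d a b) + c b m * (d a b - d a m).

Definition comm3 c d := forall a b m, Delta c d a b m = 0.

Lemma Kmx_fun_commutator c d x a b : sym0 c -> sym0 d ->
  (Kmx_fun c x *m Kmx_fun d x) a b - (Kmx_fun d x *m Kmx_fun c x) a b =
  x 0 a * x 0 b * \sum_m x 0 m ^+ 2 * Delta c d a b m.
Proof.
move=> cs ds.
(* The term on the diagonal is symmetric in e and f, hence drops out of the commutator; the rest has
   the common factor x_a x_b. *)
have prodE e f : (Kmx_fun e x *m Kmx_fun f x) a b =
    (a == b)%:R * ((\sum_m e a m * x 0 m ^+ 2) * (\sum_m f a m * x 0 m ^+ 2))
    + x 0 a * x 0 b * (\sum_m x 0 m ^+ 2 *
        (e a m * f m b - e a m * f a b - e a b * f b m)).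
  rewrite mxE; under eq_bigr do rewrite !mxE mulrBl.
  rewrite sumrB (bigD1 a) //= eqxx mul1r [X in _ + X - _]big1 ?addr0; last first.
    by move=> m ma; rewrite eq_sym (negPf ma) /= !mul0r.
  under [X in _ - X]eq_bigr do rewrite mulrBr.
  rewrite sumrB [X in _ - (X - _)](bigD1 b) //= eqxx mul1r.
  rewrite [X in _ - (_ + X - _)]big1 ?addr0; last first.
    by move=> m mb; rewrite (negPf mb) /= mul0r mulr0.
  under [X in _ = _ + _ * X]eq_bigr do rewrite !mulrBr.
  rewrite !sumrB !mulrBr !opprB.
  have -> : x 0 a * x 0 b * \sum_m x 0 m ^+ 2 * (e a m * f a b) =
    (\sum_m e a m * x 0 m ^+ 2) * (f a b * x 0 a * x 0 b).
    by rewrite mulr_suml mulr_sumr; apply: eq_bigr => m _; ring.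
  have -> : x 0 a * x 0 b * \sum_m x 0 m ^+ 2 * (e a b * f b m) =
    e a b * x 0 a * x 0 b * (\sum_m f b m * x 0 m ^+ 2).
    by rewrite !mulr_sumr; apply: eq_bigr => m _; ring.
  have -> : x 0 a * x 0 b * \sum_m x 0 m ^+ 2 * (e a m * f m b) =
    \sum_m e a m * x 0 a * x 0 m * (f m b * x 0 m * x 0 b).
    by rewrite !mulr_sumr; apply: eq_bigr => m _; ring.
  ring.
rewrite !prodE opprD addrACA -mulrBr [X in _ * X](_ : _ = 0); last ring.
rewrite mulr0 add0r -mulrBr -sumrB; congr (_ * _); apply: eq_bigr => m _.
by rewrite /Delta (sym0C m b cs) (sym0C m b ds); ring.
Qed.

Lemma comm3_endo c d : sym0 c -> sym0 d -> comm3 c d ->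
  endo_commute (Kmx c) (Kmx d).
Proof.
move=> cs ds cd s; apply/matrixP => a b; apply/eqP; rewrite -subr_eq0.
by rewrite Kmx_fun_commutator // big1 ?mulr0 // => m _; rewrite cd mulr0.
Qed.

(** At the indicator vector of three distinct indices a, b, m, the (a, b) entry of the commutator
    reduces to [Delta c d a b m], since [Delta] vanishes as soon as two indices agree. *)
Lemma endo_comm3 c d : sym0 c -> sym0 d ->
  endo_commute (Kmx c) (Kmx d) -> comm3 c d.
Proof.
move=> cs ds cd a b m.
have Daa i j : Delta c d i i j = 0 by rewrite /Delta cs.2 ds.2; ring.
have Dab i j : Delta c d i j i = 0.
  by rewrite /Delta cs.2 ds.2 (sym0C j i cs) (sym0C j i ds); ring.
have Dba i j : Delta c d i j j = 0 by rewrite /Delta cs.2 ds.2; ring.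
have [->|ab] := eqVneq a b; first exact: Daa.
have [->|ma] := eqVneq m a; first exact: Dab.
have [->|mb] := eqVneq m b; first exact: Dba.
pose x : 'rV[R]_n := \row_i ((i == a) || (i == b) || (i == m))%:R.
have xE i : x 0 i = ((i == a) || (i == b) || (i == m))%:R by rewrite mxE.
clearbody x.
have x0 : x != 0.
  by apply/eqP => /rowP /(_ a); rewrite xE mxE eqxx /= => /eqP; rewrite oner_eq0.
have E : Kmx_fun c x *m Kmx_fun d x = Kmx_fun d x *m Kmx_fun c x.
  have [s Es] := Kmx_fun_sphere x0.
  by rewrite !Es -!scalemxAl -!scalemxAr cd.
have := Kmx_fun_commutator x a b cs ds; rewrite E subrr => /esym.
rewrite (bigD1 m) //= big1 ?addr0 => [|i im].
  by rewrite !xE !eqxx !orbT /= expr1n !mul1r.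
have [->|ia] := eqVneq i a; first by rewrite Dab mulr0.
have [->|ib] := eqVneq i b; first by rewrite Dba mulr0.
by rewrite xE (negPf ia) (negPf ib) (negPf im) expr0n mul0r.
Qed.


(** Normalizing x, rescaling p and projecting it tangentially do not change the angular momenta, so
    the pull-back is a polynomial in x and p. At x = 0 it agrees with the default value 0 of
    [radial]. *)
Lemma cot_pullback_Kmx c x p : sym0 c ->
  cot_pullback (quad (Kmx c)) x p = pairing c (wedge p x) (wedge p x).
Proof.
move=> cs; rewrite /cot_pullback.
have [->|x0] := eqVneq x 0.
  rewrite radial0 /pairing big1 ?mulr0 // => a _; rewrite big1 // => b _.
  by rewrite /wedge !mxE; ring.
have [t tx ->] := radialE
  (fun t => quad (Kmx c) t (enorm x *: (p - dot (val t) p *: val t))) x0.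
rewrite /quad /Kmx Kmx_fun_form //.
suff W a b : wedge (enorm x *: (p - dot (val t) p *: val t)) (val t) a b =
    wedge p x a b by apply: pairing_ext.
rewrite /wedge !mxE; set y := dot _ _.
have ex : enorm x != 0 by rewrite enorm_eq0.
by rewrite tx !mxE; field.
Qed.

(** Up to the factors 2 and -2, the partial derivatives at (s, p) of the Hamiltonian of [Kmx c]: z =
    s for the momentum derivatives, z = p for the position derivatives. *)
Definition moment c p s i (z : 'rV[R]_n) : R :=
  \sum_b c i b * wedge p (val s) i b * z 0 b.

Lemma pairing_delta c F i z : sym0 c -> (forall a b, F b a = - F a b) ->
  pairing c F (wedge (delta_mx 0 i) z) = \sum_b c i b * F i b * z 0 b.
Proof.
move=> cs Fas.
pose X a := \sum_b c a b * F a b * z 0 b.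
suff E : \sum_a \sum_b c a b * (F a b * wedge (delta_mx 0 i) z a b) = 2 * X i.
  by rewrite /pairing E mulrA mulVf ?mul1r // pnatr_eq0.
transitivity (\sum_a (a == i)%:R * X a + \sum_a (a == i)%:R * X a); last first.
  by rewrite !sum_delta; ring.
transitivity (\sum_a \sum_b (a == i)%:R * (c a b * F a b * z 0 b) -
   \sum_a \sum_b (b == i)%:R * (c a b * F a b * z 0 a)).
  rewrite -sumrB; apply: eq_bigr => a _; rewrite -sumrB; apply: eq_bigr => b _.
  by rewrite /wedge !mxE !eqxx /=; ring.
congr (_ + _); first by apply: eq_bigr => a _; rewrite mulr_sumr.
rewrite exchange_big -sumrN; apply: eq_bigr => b _ /=.
rewrite mulr_sumr -sumrN; apply: eq_bigr => a _.
by rewrite (sym0C a b cs) (Fas b a); ring.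
Qed.

Lemma wedge_anti v x a b : wedge v x b a = - wedge v x a b.
Proof. by rewrite /wedge; ring. Qed.

Lemma derive_pairing c u (W W' : 'I_n -> 'I_n -> R)
    (f : 'rV[R]_n -> 'I_n -> 'I_n -> R) x :
  (forall h a b, f (h *: u + x) a b = W a b + h * W' a b) ->
  'D_u (fun y => pairing c (f y) (f y)) x = 2 * pairing c W W'.
Proof.
move=> fE; have PC : pairing c W' W = pairing c W W'.
  congr (_ * _); apply: eq_bigr => a _; apply: eq_bigr => b _.
  by rewrite (mulrC (W' a b)).
apply: (derive_line (q0 := pairing c W W) (q2 := pairing c W' W') (lexx 0)).
move=> h; rewrite mul0r addr0 divr1.
transitivity (pairing c (fun a b => W a b + h * W' a b)
                        (fun a b => W a b + h * W' a b)).
  by apply: pairing_ext => a b; rewrite fE.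
by rewrite pairing_line PC; ring.
Qed.

Lemma derive_pullback_pos c s p i : sym0 c ->
  'D_(delta_mx 0 i) (fun x => cot_pullback (quad (Kmx c)) x p) (val s) =
  - 2 * moment c p s i p.
Proof.
move=> cs; under eq_fun do rewrite cot_pullback_Kmx //.
rewrite (derive_pairing c (W := wedge p (val s))
  (W' := fun a b => - wedge (delta_mx 0 i) p a b)); last first.
  by move=> h a b; rewrite /wedge !mxE; ring.
rewrite mulNr -mulrN /moment -(pairing_delta (F := wedge p (val s))) //; last first.
  by move=> a b; exact: wedge_anti.
congr (_ * _); rewrite /pairing -mulrN -sumrN; congr (_ * _).
apply: eq_bigr => a _; rewrite -sumrN; apply: eq_bigr => b _; ring.
Qed.

Lemma derive_pullback_mom c s p i : sym0 c ->
  'D_(delta_mx 0 i) (fun q => cot_pullback (quad (Kmx c)) (val s) q) p =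
  2 * moment c p s i (val s).
Proof.
move=> cs; under eq_fun do rewrite cot_pullback_Kmx //.
rewrite (derive_pairing c (W := wedge p (val s))
  (W' := wedge (delta_mx 0 i) (val s))); last first.
  by move=> h a b; rewrite /wedge !mxE; ring.
rewrite (pairing_delta (F := wedge p (val s))) // => a b; exact: wedge_anti.
Qed.

Lemma comm3_poisson c d : sym0 c -> sym0 d -> comm3 c d ->
  poisson_commute (Kmx c) (Kmx d).
Proof.
move=> cs ds cd s p _; rewrite /poisson.
rewrite (eq_bigr (fun i => - 2 * moment c p s i p * (2 * moment d p s i (val s)) -
     2 * moment c p s i (val s) * (- 2 * moment d p s i p))); last first.
  move=> i _; congr (_ * _ - _ * _).
  - exact: (derive_pullback_pos s p i cs).
  - exact: (derive_pullback_mom s p i ds).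
  - exact: (derive_pullback_mom s p i cs).
  - exact: (derive_pullback_pos s p i ds).
(* T is totally antisymmetric, so that only the antisymmetrization of
   c_ib d_im, which is Delta, contributes to the bracket. *)
pose T (i b m : 'I_n) :=
  wedge p (val s) i b * wedge p (val s) i m * wedge p (val s) b m.
pose S (F : 'I_n -> 'I_n -> 'I_n -> R) := \sum_i \sum_b \sum_m F i b m.
have Sswap F : S F = S (fun i b m => F i m b).
  by apply: eq_bigr => i _; exact: exchange_big.
have Srot F : S F = S (fun i b m => F b m i).
  rewrite /S [RHS]exchange_big /=.
  by apply: eq_bigr => i _; exact: exchange_big.
pose A i b m := c i b * d i m * T i b m.
have -> : \sum_i (- 2 * moment c p s i p * (2 * moment d p s i (val s)) -
     2 * moment c p s i (val s) * (- 2 * moment d p s i p)) = - 4 * S A.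
  rewrite /S mulr_sumr; apply: eq_bigr => i _.
  transitivity (4 * (moment c p s i (val s) * moment d p s i p -
                     moment c p s i p * moment d p s i (val s))); first ring.
  rewrite mulNr -mulrN; congr (_ * _).
  rewrite !mulr_suml -sumrB -sumrN; apply: eq_bigr => b _.
  rewrite !mulr_sumr -sumrB -sumrN; apply: eq_bigr => m _.
  by rewrite /A /T /wedge; ring.
pose B i b m := A i m b.
have SB : S B = S A by rewrite [RHS]Sswap.
pose rot (F : 'I_n -> 'I_n -> 'I_n -> R) i b m := F b m i.
have SR F : S (rot F) = S F by rewrite [RHS]Srot.
(* The six permuted copies of [A] add up to [Delta] times [T], and they all have the same total sum;
   so six times [S A] is 0. *)
have S6 : S A + S (rot A) + S (rot (rot A)) +
    (S B + S (rot B) + S (rot (rot B))) = 0.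
  rewrite -!big_split big1 // => i _ /=; rewrite -!big_split big1 // => b _ /=.
  rewrite -!big_split big1 // => m _ /=.
  transitivity (Delta c d i b m * T i b m); last by rewrite cd mul0r.
  rewrite /rot /B /A /T /Delta /wedge.
  by rewrite (sym0C b i cs) (sym0C b i ds) (sym0C m i cs) (sym0C m i ds)
             (sym0C m b cs) (sym0C m b ds); ring.
move: S6; rewrite (SR (rot A)) (SR A) (SR (rot B)) (SR B) SB; move: (S A) => z z6.
have -> : z = 0 by lra.
by rewrite mulr0.
Qed.
End Commutation.

(** * Staeckel systems as spaces of matrices *)

Lemma has_dim_sum (R : realType) (E : lmodType R) k (V0 : set E)
    (V : 'I_k -> set E) m0 (m : 'I_k -> nat) :
  has_dim V0 m0 -> (forall a, has_dim (V a) (m a)) -> direct_spaces V0 V ->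
  has_dim (sum_spaces V0 V) (m0 + \sum_a m a)%N.
Proof.
move=> [b0 [b0free b0E]] /choice_dep [b bP] dirV.
have sl i : fintype.split (lshift (\sum_a m a)%N i) = inl i :> 'I_m0 + _.
  exact: (@unsplitK m0 (\sum_a m a)%N (inl i)).
have sr q : fintype.split (rshift m0 q) = inr q :> _ + 'I_(\sum_a m a)%N.
  exact: (@unsplitK m0 (\sum_a m a)%N (inr q)).
pose f (p : 'I_(m0 + \sum_a m a)%N) : E :=
  match fintype.split p with inl i => b0 i
  | inr q => b (tagnat.sig1 q) (tagnat.sig2 q) end.
have fE (c : 'I_(m0 + \sum_a m a)%N -> R) : \sum_p c p *: f p =
    \sum_i c (lshift _ i) *: b0 i +
    \sum_a \sum_i c (rshift _ (tagnat.Rank a i)) *: b a i.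
  rewrite big_split_ord /=; congr (_ + _).
    by apply: eq_bigr => i _; rewrite /f sl.
  rewrite -(big_tagnat _ (fun a i => c (rshift m0 (tagnat.Rank a i)) *: b a i)).
  apply: eq_bigr => q _; rewrite /f sr /=.
  by rewrite tagnat.sig2K.
exists f; split=> [c|].
  rewrite fE => c0.
  have [|a|z zs] := dirV _ _ _ _ c0.
  - by rewrite b0E; exists (fun i => c (lshift _ i)).
  - by rewrite (bP a).2; exists (fun i => c (rshift _ (tagnat.Rank a i))).
  move=> p; rewrite -(splitK p); case: (fintype.split p) => [i|q] /=.
    exact: (b0free (fun i => c (lshift _ i))).
  rewrite -(tagnat.sig2K q).
  exact: ((bP _).1 (fun i => c (rshift _ (tagnat.Rank _ i))) (zs _)).
apply/seteqP; split=> v.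
  move=> [v0 [w [+ + ->]]]; rewrite b0E => -[c0 ->] wV.
  have /choice_dep [c cE] : forall a, exists c : 'I_(m a) -> R,
    w a = \sum_i c i *: b a i by move=> a; have := wV a; rewrite (bP a).2.
  exists (fun p => match fintype.split p with inl i => c0 i
    | inr q => c (tagnat.sig1 q) (tagnat.sig2 q) end).
  rewrite fE; congr (_ + _).
    by apply: eq_bigr => i _; rewrite sl.
  apply: eq_bigr => a _; rewrite cE; apply: eq_bigr => i _.
  rewrite sr; congr (_ *: _).
  rewrite /tagnat.sig2 /tagnat.sig1.
  by rewrite tagnat.rankK.
move=> [c ->]; rewrite fE; do 2 eexists; split; last by [].
  by rewrite b0E; exists (fun i => c (lshift _ i)).
by move=> a; rewrite (bP a).2; exists (fun i => c (rshift _ (tagnat.Rank a i))).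
Qed.

Section Coefficients.
Variables (R : realType) (n : nat).
Implicit Types (V : set (tensor_field R n)) (c d : 'M[R]_n).

(** For diagonal Staeckel systems this set determines [V], by [diag_staeckel_eq]; the operad laws
    are all proved as equivalences between such sets. *)
Definition coefs V : set 'M[R]_n := [set c | sym0 c /\ V (Kmx c)].

Lemma diag_coefs V K : diag_staeckel V -> V K ->
  exists2 c, coefs V c & K = Kmx c.
Proof.
move=> [_ Vd] VK; have [_ [C [Ca Cd KE]]] := Vd _ VK.
have [cs CE] := curv_Kmx Ca Cd.
by exists (\matrix_(i, j) C i j i j); rewrite /coefs /= -?CE -?KE.
Qed.

Lemma coefs_comm3 V c d : diag_staeckel V -> coefs V c -> coefs V d ->
  comm3 c d.
Proof.
move=> [[_ _ _ Vc] _] [cs Vcc] [ds Vd].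
have [cd _] := Vc _ _ Vcc Vd; exact: endo_comm3 cs ds cd.
Qed.

(** Every [Kmx c] with [c] in [sym0] is Killing with a diagonal curvature tensor, and [comm3] yields
    both commutation relations, so only the dimension and [comm3] are left to check. *)
Lemma diag_staeckelI V : (0 < n)%N -> has_dim V n.-1 ->
  (forall K, V K -> exists2 c, coefs V c & K = Kmx c) ->
  (forall c d, coefs V c -> coefs V d -> comm3 c d) -> diag_staeckel V.
Proof.
move=> n0 dV VE Vc.
have VK K : V K -> killing K by move=> /VE [c [cs _] ->]; exact: Kmx_killing.
split; last first.
  move=> K VKK; split; first exact: VK.
  by have [c [cs _] ->] := VE _ VKK; exact: Kmx_curv.
split=> // K L /VE [c Cc ->] /VE [d Cd ->].
have := Vc _ _ Cc Cd; case: Cc Cd => cs _ [ds _] cd.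
by split; [exact: comm3_endo|exact: comm3_poisson].
Qed.

Lemma diag_staeckel_eq V W : diag_staeckel V -> diag_staeckel W ->
  (forall c, coefs V c <-> coefs W c) -> V = W.
Proof.
move=> dV dW VW; apply/seteqP; split=> K.
  by move=> /(diag_coefs dV) [c /VW [_ Wc] ->].
by move=> /(diag_coefs dW) [c /VW [_ Wc] ->].
Qed.

End Coefficients.

(** The map [g] is only known on fields [Kmx c], where it acts through the linear map [L]. A basis
    of [V] is therefore lifted to matrices, and its image under [L] gives the basis of the image. *)
Lemma has_dim_Kmx_image (R : realType) k n m (V : set (tensor_field R k))
    (g : tensor_field R k -> tensor_field R n)
    (L : {linear 'M[R]_k -> 'M[R]_n}) :
  (forall K, V K -> exists2 c, coefs V c & K = Kmx c) ->
  (forall c, sym0 c -> g (Kmx c) = Kmx (L c)) ->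
  (forall c, sym0 c -> sym0 (L c)) ->
  (forall c, sym0 c -> L c = 0 -> c = 0) ->
  has_dim V m -> has_dim (g @` V) m.
Proof.
move=> VE gE Ls Linj [b [bfree bE]].
have /choice [w wP] : forall i, exists c, coefs V c /\ b i = Kmx c.
  move=> i; have [|c Vc bc] := VE (b i); last by exists c.
  rewrite bE; exists (fun j => (i == j)%:R).
  rewrite (bigD1 i) //= eqxx scale1r big1 ?addr0 // => j /negPf.
  by rewrite eq_sym => ->; rewrite scale0r.
have ws i : sym0 (w i) by have [[]] := wP i.
have KE (N : nat) (x : 'I_m -> R) (u : 'I_m -> 'M[R]_N) :
    \sum_i x i *: Kmx (u i) = Kmx (\sum_i x i *: u i).
  by rewrite Kmx_sum; apply: eq_bigr => i _; rewrite KmxZ.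
have LE (x : 'I_m -> R) : \sum_i x i *: Kmx (L (w i)) =
    Kmx (L (\sum_i x i *: w i)).
  rewrite KE; congr Kmx; rewrite linear_sum.
  by apply: eq_bigr => i _; rewrite linearZ.
have bw (x : 'I_m -> R) : \sum_i x i *: b i = Kmx (\sum_i x i *: w i).
  by rewrite -KE; apply: eq_bigr => i _; rewrite (wP i).2.
exists (fun i => Kmx (L (w i))); split=> [x|].
  rewrite LE => x0; apply: bfree; rewrite bw.
  have xs : sym0 (\sum_i x i *: w i) by exact: sym0_sum.
  rewrite (Linj _ xs); first by rewrite Kmx0.
  apply: (Kmx_inj (Ls _ xs) (sym00 _ _)).
  by rewrite x0 Kmx0.
apply/seteqP; split=> K.
  move=> [K0 + <-]; rewrite bE => -[x ->]; exists x.
  by rewrite LE bw gE //; exact: sym0_sum.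
move=> [x ->]; exists (\sum_i x i *: b i); first by rewrite bE; exists x.
by rewrite LE bw gE //; exact: sym0_sum.
Qed.

(** * Composition of Staeckel systems on the level of matrices *)

Definition tg k (n_ : 'I_k -> nat) a (i : 'I_(n_ a)) : {a & 'I_(n_ a)} :=
  Tagged (fun a => 'I_(n_ a)) i.

Section Composition.
Variables (R : realType) (k n : nat) (n_ : 'I_k -> nat).
Variable e : {a : 'I_k & 'I_(n_ a)} -> 'I_n.
Hypothesis eb : bijective e.
Let ei : injective e := bij_inj eb.
Notation t_ := (@tg k n_).

Lemma sum_tg t a (F : 'I_(n_ a) -> R) :
  tag t != a -> \sum_i (t == t_ i)%:R * F i = 0.
Proof.
move=> ta; rewrite big1 // => i _; have [tE|_] := eqVneq t (t_ i).
  by rewrite tE eqxx in ta.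
by rewrite mul0r.
Qed.

Lemma sum_tg1 a (i : 'I_(n_ a)) (F : 'I_(n_ a) -> R) :
  \sum_j (t_ i == t_ j)%:R * F j = F i.
Proof.
rewrite (bigD1 i) //= eqxx mul1r big1 ?addr0 // => j ji.
by rewrite eq_Tagged /= eq_sym (negPf ji) mul0r.
Qed.

(** Written with elementary matrices so that applying [Kmx] term by term gives [iota0]; [inner_mx]
    plays the same role for [iota1]. *)
Definition outer_mx (c : 'M[R]_k) : 'M[R]_n :=
  \sum_a \sum_b c a b *:
    \sum_(i < n_ a) \sum_(j < n_ b) delta_mx (e (t_ i)) (e (t_ j)).

Definition inner_mx a (c : 'M[R]_(n_ a)) : 'M[R]_n :=
  \sum_i \sum_j c i j *: delta_mx (e (t_ i)) (e (t_ j)).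

Lemma outer_mx_linear : linear outer_mx.
Proof.
move=> x c d; rewrite scaler_sumr -big_split; apply: eq_bigr => a _ /=.
rewrite scaler_sumr -big_split; apply: eq_bigr => b _ /=.
by rewrite !mxE scalerDl scalerA.
Qed.
HB.instance Definition _ :=
  GRing.isLinear.Build R 'M[R]_k 'M[R]_n _ outer_mx outer_mx_linear.

Lemma inner_mx_linear a : linear (@inner_mx a).
Proof.
move=> x c d; rewrite scaler_sumr -big_split; apply: eq_bigr => i _ /=.
rewrite scaler_sumr -big_split; apply: eq_bigr => j _ /=.
by rewrite !mxE scalerDl scalerA.
Qed.
HB.instance Definition _ a :=
  GRing.isLinear.Build R 'M[R]_(n_ a) 'M[R]_n _ (@inner_mx a) (@inner_mx_linear a).

Lemma outer_mx0 : outer_mx 0 = 0. Proof. exact: linear0. Qed.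

Lemma inner_mx0 a : inner_mx (0 : 'M[R]_(n_ a)) = 0.
Proof. exact: linear0. Qed.

Lemma outer_mxE c t t' : outer_mx c (e t) (e t') = c (tag t) (tag t').
Proof.
have dE (u : {a & 'I_(n_ a)}) (a : 'I_k) :
    \sum_(i < n_ a) (u == t_ i)%:R = (tag u == a)%:R :> R.
  rewrite (eq_bigr (fun i : 'I_(n_ a) => (u == t_ i)%:R * 1)); last first.
    by move=> i _; rewrite mulr1.
  case: u => b i /=; have [ba|ba] := eqVneq b a; last by rewrite sum_tg.
  by subst b; rewrite (sum_tg1 i).
rewrite summxE.
transitivity (\sum_a (tag t == a)%:R * \sum_b (tag t' == b)%:R * c a b).
  apply: eq_bigr => a _; rewrite summxE mulr_sumr; apply: eq_bigr => b _.
  rewrite mxE summxE mulrA -dE -dE mulrC; congr (_ * _).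
  rewrite mulr_suml; apply: eq_bigr => i _; rewrite summxE mulr_sumr.
  by apply: eq_bigr => j _; rewrite mxE !(inj_eq ei) -mulnb natrM.
rewrite (bigD1 (tag t)) //= eqxx mul1r [X in _ + X]big1 ?addr0 => [|a]; last first.
  by rewrite eq_sym => /negPf ->; rewrite mul0r.
rewrite (bigD1 (tag t')) //= eqxx mul1r [X in _ + X]big1 ?addr0 => // a.
by rewrite eq_sym => /negPf ->; rewrite mul0r.
Qed.

Lemma inner_mx_entry a (c : 'M[R]_(n_ a)) t t' :
  inner_mx c (e t) (e t') =
  \sum_i (t == t_ i)%:R * \sum_j (t' == t_ j)%:R * c i j.
Proof.
rewrite /inner_mx summxE; apply: eq_bigr => i _; rewrite summxE.
rewrite mulr_sumr; apply: eq_bigr => j _.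
by rewrite !mxE !(inj_eq ei) -mulnb natrM; ring.
Qed.

Lemma inner_mxE a (c : 'M[R]_(n_ a)) i j :
  inner_mx c (e (t_ i)) (e (t_ j)) = c i j.
Proof. by rewrite inner_mx_entry (sum_tg1 i) (sum_tg1 j). Qed.

Lemma inner_mx_out a (c : 'M[R]_(n_ a)) t t' :
  (tag t != a) || (tag t' != a) -> inner_mx c (e t) (e t') = 0.
Proof.
rewrite inner_mx_entry => /orP [ta|ta]; first by rewrite sum_tg.
by rewrite big1 // => i _; rewrite sum_tg // mulr0.
Qed.

Lemma mx_entriesP (c d : 'M[R]_n) :
  (forall t t', c (e t) (e t') = d (e t) (e t')) -> c = d.
Proof.
by case: eb => g _ gK cd; apply/matrixP => p q; rewrite -(gK p) -(gK q).
Qed.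

Lemma sym0_entriesP (c : 'M[R]_n) :
  (forall t t', c (e t) (e t') = c (e t') (e t)) ->
  (forall t, c (e t) (e t) = 0) -> sym0 c.
Proof.
move=> cs c0; split; first by apply: mx_entriesP => t t'; rewrite mxE.
by case: eb => g _ gK p; rewrite -(gK p).
Qed.

Lemma sym0_outer c : sym0 c -> sym0 (outer_mx c).
Proof.
move=> cs; apply: sym0_entriesP => [t t'|t]; rewrite !outer_mxE.
  exact: sym0C.
exact: cs.2.
Qed.

Lemma sym0_inner a (c : 'M[R]_(n_ a)) : sym0 c -> sym0 (inner_mx c).
Proof.
move=> cs; apply: sym0_entriesP => [[b i] [b' j]|[b i]].
  have [ba|ba] := eqVneq b a; last by rewrite !inner_mx_out //= ba ?orbT.
  have [ba'|ba'] := eqVneq b' a; last by rewrite !inner_mx_out //= ba' ?orbT.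
  by subst b b'; rewrite !inner_mxE (sym0C _ _ cs).
have [ba|ba] := eqVneq b a; last by rewrite !inner_mx_out //= ba ?orbT.
by subst b; rewrite !inner_mxE cs.2.
Qed.

Lemma iota0_Kmx c : sym0 c -> iota0 e (Kmx c) = Kmx (outer_mx c).
Proof.
move=> cs; rewrite /iota0 (linext_Kmx (w := fun a b =>
  Kmx (\sum_(i < n_ a) \sum_(j < n_ b) delta_mx (e (t_ i)) (e (t_ j))))) //.
  rewrite Kmx_sum; apply: eq_bigr => a _; rewrite Kmx_sum.
  by apply: eq_bigr => b _; rewrite KmxZ.
move=> a b; rewrite -KmxD [X in _ + X]exchange_big -big_split Kmx_sum.
apply: eq_bigr => i _ /=; rewrite -big_split Kmx_sum.
by apply: eq_bigr => j _; rewrite Kb_Kmx.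
Qed.

Lemma iota1_Kmx a (c : 'M[R]_(n_ a)) : sym0 c ->
  iota1 e (Kmx c) = Kmx (inner_mx c).
Proof.
move=> cs; rewrite /iota1 (linext_Kmx (w := fun i j =>
  Kmx (delta_mx (e (t_ i)) (e (t_ j))))) //.
  rewrite Kmx_sum; apply: eq_bigr => i _; rewrite Kmx_sum.
  by apply: eq_bigr => j _; rewrite KmxZ.
by move=> i j; rewrite -KmxD Kb_Kmx.
Qed.

Definition block a (d : 'M[R]_n) : 'M[R]_(n_ a) :=
  \matrix_(i, j) d (e (t_ i)) (e (t_ j)).

Definition comp_mx (c0 : 'M[R]_k) (c : forall a, 'M[R]_(n_ a)) : 'M[R]_n :=
  outer_mx c0 + \sum_a inner_mx (c a).

(** Inside block a the outer part has the constant value c0 a a, which is 0. *)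
Lemma block_comp_mx c0 c a : sym0 c0 -> block a (comp_mx c0 c) = c a.
Proof.
move=> c0s; apply/matrixP => i j; rewrite !mxE outer_mxE /= c0s.2 add0r summxE.
rewrite (bigD1 a) //= big1 ?addr0 ?inner_mxE // => b ba.
by rewrite inner_mx_out //= eq_sym ba.
Qed.

Lemma comp_mx_outer c0 c t t' : tag t != tag t' ->
  comp_mx c0 c (e t) (e t') = c0 (tag t) (tag t').
Proof.
move=> tt; rewrite mxE outer_mxE summxE big1 ?addr0 // => a _.
rewrite inner_mx_out //; have [ta|] //= := eqVneq (tag t) a.
by rewrite -ta eq_sym.
Qed.

Lemma sym0_comp_mx c0 c : sym0 c0 -> (forall a, sym0 (c a)) -> sym0 (comp_mx c0 c).
Proof.
move=> c0s cs; rewrite /comp_mx -[outer_mx _]scale1r; apply: sym0_lin.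
  exact: sym0_outer.
rewrite (eq_bigr (fun a => 1 *: inner_mx (c a))); last by move=> *; rewrite scale1r.
by apply: sym0_sum => a; exact: sym0_inner.
Qed.

Lemma Kmx_comp_mx c0 c : sym0 c0 -> (forall a, sym0 (c a)) ->
  Kmx (comp_mx c0 c) = iota0 e (Kmx c0) + \sum_a iota1 e (Kmx (c a)).
Proof.
move=> c0s cs; rewrite KmxD Kmx_sum iota0_Kmx //; congr (_ + _).
by apply: eq_bigr => a _; rewrite iota1_Kmx.
Qed.

Lemma comp_mx_block (d : 'M[R]_n) c0 : sym0 c0 ->
  (forall t t', tag t != tag t' -> d (e t) (e t') = c0 (tag t) (tag t')) ->
  d = comp_mx c0 (fun a => block a d).
Proof.
move=> c0s dE; apply: mx_entriesP => -[a i] [b j].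
have [ab|ab] := eqVneq a b; last by rewrite comp_mx_outer //= dE.
subst b; have /matrixP /(_ i j) := block_comp_mx (fun a => block a d) a c0s.
by rewrite !mxE.
Qed.

Variables (V0 : set (tensor_field R k)) (V : forall a, set (tensor_field R (n_ a))).
Arguments V : clear implicits.
Hypotheses (dV0 : diag_staeckel V0) (dV : forall a, diag_staeckel (V a)).
Arguments dV : clear implicits.

Lemma compP K : staeckel_comp e V0 V K <->
  exists c0 c,
    [/\ coefs V0 c0, forall a, coefs (V a) (c a) & K = Kmx (comp_mx c0 c)].
Proof.
split.
  move=> [_ [w [[K0 VK0 <-] wV ->]]].
  have [c0 [c0s Vc0] ->] := diag_coefs dV0 VK0.
  have /choice_dep [c cP] a : exists c, coefs (V a) c /\ w a = iota1 e (Kmx c).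
    have [K1 VK1 <-] := wV a; have [c Vc ->] := diag_coefs (dV a) VK1.
    by exists c.
  exists c0, c; split=> // [a|]; first by have [] := cP a.
  rewrite Kmx_comp_mx //; last by move=> a; have [[]] := cP a.
  by congr (_ + _); apply: eq_bigr => a _; have [] := cP a.
move=> [c0 [c [[c0s Vc0] Vc ->]]]; rewrite Kmx_comp_mx //; last first.
  by move=> a; have [] := Vc a.
exists (iota0 e (Kmx c0)), (fun a => iota1 e (Kmx (c a))); split=> //.
by move=> a; exists (Kmx (c a)) => //; have [] := Vc a.
Qed.

(** The inner components of [d] are its diagonal blocks, hence no longer need to be chosen; only the
    outer component [c0] remains existential. The operad laws are checked in this form. *)
Lemma coefs_comp d : coefs (staeckel_comp e V0 V) d <->
  [/\ sym0 d, forall a, coefs (V a) (block a d) & exists2 c0, coefs V0 c0 &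
    forall t t', tag t != tag t' -> d (e t) (e t') = c0 (tag t) (tag t')].
Proof.
split=> [[ds /compP [c0 [c [Vc0 Vc dE]]]]|[ds Vd [c0 Vc0 dE]]].
  have {}dE : d = comp_mx c0 c.
    apply: Kmx_inj dE => //; apply: sym0_comp_mx; first exact: Vc0.1.
    by move=> a; exact: (Vc a).1.
  split=> // [a|]; first by rewrite dE block_comp_mx //; exact: Vc0.1.
  by exists c0 => // t t' tt; rewrite dE comp_mx_outer.
split=> //; apply/compP; exists c0, (fun a => block a d); split=> //.
by rewrite -comp_mx_block //; exact: Vc0.1.
Qed.

Lemma block_gt0 a : (0 < n_ a)%N.
Proof. by have [[]] := dV a. Qed.

(** The matrix of a vanishing sum is 0. Its blocks are the inner components, and its entries between
    two blocks are those of [c0], which can be read off because no block is empty. *)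
Lemma comp_direct :
  direct_spaces (iota0 e @` V0) (fun a => iota1 e (a := a) @` V a).
Proof.
move=> _ w [K0 VK0 <-] wV.
have [c0 [c0s Vc0] ->] := diag_coefs dV0 VK0.
have /choice_dep [c cP] a : exists c, coefs (V a) c /\ w a = iota1 e (Kmx c).
  have [K1 VK1 <-] := wV a; have [c Vc ->] := diag_coefs (dV a) VK1.
  by exists c.
have cs a : sym0 (c a) by have [[]] := cP a.
rewrite (eq_bigr (fun a => iota1 e (Kmx (c a)))); last first.
  by move=> a _; have [] := cP a.
rewrite -Kmx_comp_mx // => g0.
have {}g0 : comp_mx c0 c = 0.
  by apply: (Kmx_inj (sym0_comp_mx c0s cs) (sym00 _ _)); rewrite g0 Kmx0.
have -> : c0 = 0.
  apply/matrixP => a b; rewrite mxE; have [->|ab] := eqVneq a b; first exact: c0s.2.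
  have := comp_mx_outer c0 c (t := t_ (Ordinal (block_gt0 a)))
    (t' := t_ (Ordinal (block_gt0 b))) ab.
  by rewrite g0 mxE.
split.
  by rewrite iota0_Kmx; [rewrite outer_mx0 Kmx0|exact: sym00].
move=> a; have [_ ->] := cP a; rewrite iota1_Kmx // -(block_comp_mx c a c0s) g0.
rewrite (_ : block a 0 = 0); first by rewrite inner_mx0 Kmx0.
by apply/matrixP => i j; rewrite !mxE.
Qed.

Lemma comp_staeckel : diag_staeckel (staeckel_comp e V0 V).
Proof.
have k0 : (0 < k)%N by have [[]] := dV0.
have nE : n = (\sum_a n_ a)%N.
  by rewrite -(@tagnat.card k n_) (bij_eq_card eb) card_ord.
(* The predecessor truncates at 0, so this count relies on all blocks being nonempty. *)
have sE : (\sum_a n_ a = \sum_a (n_ a).-1 + k)%N.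
  rewrite (eq_bigr (fun a => (n_ a).-1 + 1)%N); last first.
    by move=> a _; rewrite addn1 prednK // block_gt0.
  by rewrite big_split /= sum1_card card_ord.
apply: diag_staeckelI.
- by rewrite nE sE addn_gt0 k0 orbT.
- have -> : n.-1 = (k.-1 + \sum_a (n_ a).-1)%N by rewrite nE sE; lia.
  apply: has_dim_sum comp_direct.
    apply: (has_dim_Kmx_image (L := outer_mx)).
    + by move=> K; exact: diag_coefs.
    + exact: iota0_Kmx.
    + exact: sym0_outer.
    + move=> c _ c0; apply/matrixP => a b.
      have := outer_mxE c (t_ (Ordinal (block_gt0 a))) (t_ (Ordinal (block_gt0 b))).
      by rewrite c0 !mxE.
    + by have [[]] := dV0.
  move=> a; apply: (has_dim_Kmx_image (L := @inner_mx a)).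
  + by move=> K; exact: diag_coefs.
  + exact: iota1_Kmx.
  + exact: sym0_inner.
  + by move=> c _ c0; apply/matrixP => i j; rewrite -inner_mxE c0 !mxE.
  + by have [[]] := dV a.
- move=> K VK; have [c0 [c [Vc0 Vc KE]]] := (compP K).1 VK.
  exists (comp_mx c0 c) => //; split; last by rewrite -KE.
  by apply: sym0_comp_mx; [exact: Vc0.1|move=> a; exact: (Vc a).1].
move=> d d' /coefs_comp [ds Vd [c0 Vc0 dE]] /coefs_comp [ds' Vd' [c0' Vc0' dE']].
have cc := coefs_comm3 dV0 Vc0 Vc0'.
have cb a := coefs_comm3 (dV a) (Vd a) (Vd' a).
suff H t t' t'' : Delta d d' (e t) (e t') (e t'') = 0.
  by case: eb => g _ gK p q r; rewrite -(gK p) -(gK q) -(gK r).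
case: t t' t'' => [a i] [b j] [m l].
(* Pairs the two equations, so that one rewrite replaces the entries of both [d] and [d'] between
   two blocks. *)
pose dd u v h := (dE u v h, dE' u v h).
have [ab|ab] := eqVneq a b.
  subst b; have [am|am] := eqVneq a m.
    by subst m; have := cb a i j l; rewrite /Delta !mxE.
  rewrite /Delta !(dd (existT _ a i) (existT _ m l) am).
  by rewrite !(dd (existT _ a j) (existT _ m l) am) /=; ring.
have ba : b != a by rewrite eq_sym.
have [am|am] := eqVneq a m.
  subst m; rewrite /Delta !(dd (existT _ a i) (existT _ b j) ab).
  rewrite !(dd (existT _ b j) (existT _ a l) ba) /=.
  by rewrite (sym0C b a Vc0.1) (sym0C b a Vc0'.1); ring.
have [bm|bm] := eqVneq b m.
  subst m; rewrite /Delta !(dd (existT _ a i) (existT _ b j) ab).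
  by rewrite !(dd (existT _ a i) (existT _ b l) ab) /=; ring.
rewrite /Delta !(dd (existT _ a i) (existT _ b j) ab).
rewrite !(dd (existT _ a i) (existT _ m l) am).
by rewrite !(dd (existT _ b j) (existT _ m l) bm); exact: cc.
Qed.

End Composition.

(** * Operad axioms *)

Lemma sym0_mxsub (R : realType) m n (f : 'I_m -> 'I_n) (c : 'M[R]_n) :
  sym0 c -> sym0 (mxsub f f c).
Proof.
move=> cs; split=> [|i]; last by rewrite mxE cs.2.
by apply/matrixP => i j; rewrite !mxE; exact: sym0C.
Qed.

Lemma sym0_mxsubI (R : realType) m n (f : 'I_m -> 'I_n) g (c : 'M[R]_n) :
  cancel g f -> sym0 (mxsub f f c) -> sym0 c.
Proof.
move=> gK /(sym0_mxsub g); congr sym0.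
by apply/matrixP => i j; rewrite !mxE !gK.
Qed.

(** * The action of the symmetric group *)

Section PermutationAction.
Variables (R : realType) (n : nat) (s : 'S_n).

(* The action of s is [iota1] for a partition into a single block. *)
Let emb (t : {a : 'I_1 & 'I_n}) : 'I_n := s (tagged t).

Let emb_bij : bijective emb.
Proof.
exists (fun p => existT (fun _ : 'I_1 => 'I_n) ord0 (s^-1%g p)) => [[a i]|p].
  by rewrite (ord1 a) /emb /= permK.
by rewrite /emb /= permKV.
Qed.

Let pmx (c : 'M[R]_n) : 'M[R]_n := @inner_mx R 1 n (fun=> n) emb ord0 c.

Let perm_act_Kmx c : sym0 c -> perm_act s (Kmx c) = Kmx (pmx c).
Proof. exact: (@iota1_Kmx R 1 n (fun=> n) emb ord0). Qed.

Let pmxE c i j : pmx c (s i) (s j) = c i j.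
Proof. exact: (inner_mxE emb_bij (a := ord0)). Qed.

Let sym0_pmx c : sym0 c -> sym0 (pmx c).
Proof. exact: (sym0_inner emb_bij). Qed.

Let pmxK c : mxsub s s (pmx c) = c.
Proof. by apply/matrixP => i j; rewrite mxE pmxE. Qed.

Let pmxVK c : pmx (mxsub s s c) = c.
Proof.
apply/matrixP => i j; rewrite -(permKV s i) -(permKV s j) pmxE.
by rewrite mxE.
Qed.

Variable V : set (tensor_field R n).
Hypothesis dV : diag_staeckel V.

(** The action moves K_ij to K_s(i)s(j), so the preimage has the coefficient c (s i) (s j) at
    K_ij. *)
Lemma coefs_perm c : coefs (perm_act s @` V) c <-> coefs V (mxsub s s c).
Proof.
split=> [[cs [K VK]]|[cs Vc]].
  have [c0 [c0s Vc0] ->] := diag_coefs dV VK; rewrite perm_act_Kmx // => E.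
  by have <- := Kmx_inj (sym0_pmx c0s) cs E; rewrite pmxK.
split; first exact: sym0_mxsubI (permKV s) cs.
by exists (Kmx (mxsub s s c)) => //; rewrite perm_act_Kmx // pmxVK.
Qed.

Lemma perm_staeckel : diag_staeckel (perm_act s @` V).
Proof.
have [[n0 dimV _ _] _] := dV.
apply: diag_staeckelI => //.
- apply: (has_dim_Kmx_image (L := @inner_mx R 1 n (fun=> n) emb ord0)) dimV.
  + by move=> K; exact: diag_coefs.
  + exact: perm_act_Kmx.
  + exact: sym0_pmx.
  + move=> c _ c0; rewrite -(pmxK c) /pmx c0.
    by apply/matrixP => i j; rewrite !mxE.
- move=> _ [K VK <-]; have [c0 [c0s Vc0] ->] := diag_coefs dV VK.
  exists (pmx c0); last by rewrite perm_act_Kmx.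
  split; first exact: sym0_pmx.
  by exists (Kmx c0) => //; rewrite perm_act_Kmx.
move=> c d /coefs_perm Vc /coefs_perm Vd p q r.
have := coefs_comm3 dV Vc Vd (s^-1%g p) (s^-1%g q) (s^-1%g r).
by rewrite /Delta !mxE !permKV.
Qed.

End PermutationAction.

(** * The zero-dimensional system on the sphere of dimension 0 *)

Section Unit.
Variable R : realType.

Lemma sym0_dim1 (c : 'M[R]_1) : sym0 c -> c = 0.
Proof. by move=> cs; apply/matrixP => i j; rewrite !ord1 cs.2 mxE. Qed.

Lemma unit_staeckel : diag_staeckel [set 0 : tensor_field R 1].
Proof.
have comm (c d : 'M[R]_1) : sym0 c -> comm3 c d.
  by move=> /sym0_dim1 -> i j l; rewrite /Delta !mxE; ring.
apply: diag_staeckelI => //.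
- exists (fun=> 0); split=> [c _ []//|].
  apply/seteqP; split=> [K ->|K [c ->]]; last by rewrite /= big_ord0.
  by exists (fun=> 0); rewrite big_ord0.
- move=> K ->; exists 0; last by rewrite Kmx0.
  by split; [exact: sym00|rewrite /= Kmx0].
by move=> c d [cs _] _; exact: comm.
Qed.

Lemma coefs_unit (c : 'M[R]_1) : coefs [set 0] c <-> sym0 c.
Proof.
split=> [[]//|cs]; split=> //=.
by rewrite (sym0_dim1 cs) Kmx0.
Qed.

End Unit.

Section Equality.
Variable R : realType.

Lemma DStaeckel_eq n (X Y : DStaeckel R n) :
  (forall c, coefs (sval X) c <-> coefs (sval Y) c) -> X = Y.
Proof.
case: X Y => [V dV] [W dW] /= /(diag_staeckel_eq dV dW) VW; subst W.
by rewrite (Prop_irrelevance dV dW).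
Qed.

(** Eliminating the equality [h] of the two sizes makes the casts trivial, so equalities in the
    total space become comparisons of reindexed matrices. *)
Lemma DStaeckel_Tagged m n (h : m = n) (X : DStaeckel R m) (Y : DStaeckel R n) :
  (forall c : 'M[R]_n, coefs (sval X) (mxsub (cast_ord h) (cast_ord h) c) <->
     coefs (sval Y) c) ->
  Tagged (DStaeckel R) X = Tagged (DStaeckel R) Y.
Proof.
case: n / h Y => Y XY; congr Tagged; apply: DStaeckel_eq => c.
rewrite -XY; suff -> : mxsub (cast_ord (erefl m)) (cast_ord (erefl m)) c = c by [].
by apply/matrixP => i j; rewrite mxE !cast_ord_id.
Qed.

End Equality.

(** * Composition, action and their laws *)

Section OperadLaws.
Variable R : realType.

Definition dcomp k (n_ : 'I_k -> nat) (X0 : DStaeckel R k)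
    (X : forall a, DStaeckel R (n_ a)) : DStaeckel R (\sum_a n_ a) :=
  exist _ _ (comp_staeckel (@tagnat.rank_bij k n_) (svalP X0)
    (fun a => svalP (X a))).

Definition dact n (X : DStaeckel R n) (s : 'S_n) : DStaeckel R n :=
  exist _ _ (perm_staeckel s (svalP X)).

Definition dunit : DStaeckel R 1 := exist _ _ (unit_staeckel R).

Lemma coefs_dcomp k (n_ : 'I_k -> nat) (X0 : DStaeckel R k)
    (X : forall a, DStaeckel R (n_ a)) d :
  coefs (sval (dcomp X0 X)) d <->
  [/\ sym0 d, forall a, coefs (sval (X a)) (block (@tagnat.rank k n_) a d) &
    exists2 c0, coefs (sval X0) c0 &
      forall a i b j, a != b -> d (tagnat.Rank a i) (tagnat.Rank b j) = c0 a b].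
Proof.
apply: iff_trans (coefs_comp (@tagnat.rank_bij k n_) (svalP X0)
    (fun a => svalP (X a)) d) _.
split=> -[ds Xd [c0 Xc0 E]]; split=> //; exists c0 => //.
  by move=> a i b j ab; exact: (E (Tagged _ i) (Tagged _ j)).
by move=> [a i] [b j]; exact: E.
Qed.

Lemma coefs_dact n (X : DStaeckel R n) (s : 'S_n) d :
  coefs (sval (dact X s)) d <-> coefs (sval X) (mxsub s s d).
Proof. exact: (coefs_perm s (svalP X)). Qed.

Lemma coefs_dunit d : coefs (sval dunit) d <-> sym0 d.
Proof. exact: coefs_unit. Qed.

Lemma dact1 n (X : DStaeckel R n) : dact X 1%g = X.
Proof.
apply: DStaeckel_eq => c; apply: iff_trans (coefs_dact _ _ _) _.
suff -> : mxsub (1%g : 'S_n) (1%g : 'S_n) c = c by [].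
by apply/matrixP => i j; rewrite mxE !perm1.
Qed.

Lemma dactM n (X : DStaeckel R n) (s t : 'S_n) :
  dact X (s * t)%g = dact (dact X s) t.
Proof.
apply: DStaeckel_eq => c.
apply: iff_trans (coefs_dact _ _ _) (iff_sym _).
apply: iff_trans (coefs_dact _ _ _) _; apply: iff_trans (coefs_dact _ _ _) _.
suff -> : mxsub s s (mxsub t t c) = mxsub (s * t)%g (s * t)%g c by [].
by apply/matrixP => i j; rewrite !mxE !permM.
Qed.

(** All blocks have size one, so [Y] governs every entry off the diagonal, and the diagonal entries
    vanish. *)
Lemma dcomp1r k (Y : DStaeckel R k) :
  Tagged (DStaeckel R) (dcomp Y (fun _ : 'I_k => dunit)) =
  Tagged (DStaeckel R) Y.
Proof.
have h : (\sum_(a < k) 1 = k)%N by rewrite sum1_card card_ord.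
have rk a i : cast_ord h (@tagnat.Rank k (fun=> 1%N) a i) = a.
  apply: val_inj; rewrite -[LHS]/(nat_of_ord (tagnat.Rank a i)).
  rewrite tagnat.RankEsum (sum_lt_ord (fun=> 1%N)).
  by rewrite sum1_card card_ord (ord1 i) addn0.
apply: (DStaeckel_Tagged (h := h)) => c.
apply: iff_trans (coefs_dcomp _ _ _) _; split.
  move=> [cs _ [c0 Yc0 E]]; suff -> : c = c0 by [].
  apply/matrixP => a b; have [->|ab] := eqVneq a b.
    have := cs.2 (tagnat.Rank b ord0); rewrite mxE rk => ->.
    by rewrite (Yc0.1).2.
  by have := E a ord0 b ord0 ab; rewrite mxE !rk.
move=> Yc; have cs := sym0_mxsub (cast_ord h) Yc.1; split=> //.
  by move=> a; apply/coefs_dunit; exact: (sym0_mxsub _ cs).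
by exists c => // a i b j _; rewrite mxE !rk.
Qed.

(** There is a single block, so the condition on entries between different blocks is vacuous. *)
Lemma dcomp1l n (Y : DStaeckel R n) :
  Tagged (DStaeckel R) (dcomp dunit (fun _ : 'I_1 => Y)) =
  Tagged (DStaeckel R) Y.
Proof.
have h : (\sum_(a < 1) n = n)%N by rewrite big_ord1.
have rk a i : cast_ord h (@tagnat.Rank 1 (fun=> n) a i) = i.
  apply: val_inj; rewrite -[LHS]/(nat_of_ord (tagnat.Rank a i)).
  rewrite tagnat.RankEsum (sum_lt_ord (fun=> n)).
  by rewrite (ord1 a) big_ord0.
have bE a c : block (@tagnat.rank 1 (fun=> n)) a
    (mxsub (cast_ord h) (cast_ord h) c) = c :> 'M[R]_n.
  by apply/matrixP => i j; rewrite !mxE !rk.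
apply: (DStaeckel_Tagged (h := h)) => c.
apply: iff_trans (coefs_dcomp _ _ _) _; split.
  by move=> [_ /(_ ord0) + _]; rewrite bE.
move=> Yc; split; first exact: (sym0_mxsub _ Yc.1).
  by move=> a; rewrite bE.
exists 0; first by apply/coefs_dunit; exact: sym00.
by move=> a i b j; rewrite (ord1 a) (ord1 b).
Qed.

(** On both sides [X] governs the innermost blocks, [Y] the entries between innermost blocks of one
    outer block, and [Z] those between different outer blocks. *)
Lemma dcompA k (n_ : 'I_k -> nat) (m_ : forall a, 'I_(n_ a) -> nat)
    (Z : DStaeckel R k) (Y : forall a, DStaeckel R (n_ a))
    (X : forall a i, DStaeckel R (m_ a i)) :
  Tagged (DStaeckel R) (dcomp Z (fun a => dcomp (Y a) (X a))) =
  Tagged (DStaeckel R) (dcomp (dcomp Z Y)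
    (fun p => X (tagnat.sig1 p) (tagnat.sig2 p))).
Proof.
pose M p := m_ (tagnat.sig1 p) (tagnat.sig2 p).
have h : (\sum_a \sum_i m_ a i = \sum_p M p)%N by rewrite -big_tagnat.
pose r a i (l : 'I_(m_ a i)) : 'I_(\sum_a \sum_i m_ a i) :=
  tagnat.Rank a (tagnat.Rank i l).
(* The two ways of nesting number the innermost indices alike. *)
have rE p (l : 'I_(M p)) : cast_ord h (r _ _ l) = @tagnat.Rank _ M p l.
  apply: val_inj; rewrite -[LHS]/(nat_of_ord (r _ _ l)).
  have := sum_lt_Rank m_ (tagnat.sig2 p); rewrite tagnat.sig2K => EM.
  rewrite !tagnat.RankEsum addnA -EM; apply: esym.
  exact: (@tagnat.RankEsum _ M p l).
apply: (DStaeckel_Tagged (h := h)) => c; set d := mxsub (cast_ord h) _ c.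
have dE p l q l' : c (@tagnat.Rank _ M p l) (@tagnat.Rank _ M q l') =
    d (r _ _ l) (r _ _ l') by rewrite mxE !rE.
apply: iff_trans (coefs_dcomp _ _ _) (iff_sym _).
apply: iff_trans (coefs_dcomp _ _ _) _.
split=> -[ds H1 [c0 H0 E]].
  have cs : sym0 d by exact: sym0_mxsub.
  have [w0s wY [z0 Zz0 Ew]] := (coefs_dcomp _ _ _).1 H0.
  have dw a i l b j l' : Tagged _ i != Tagged _ j :> {a & 'I_(n_ a)} ->
      d (@r a i l) (@r b j l') = c0 (tagnat.Rank a i) (tagnat.Rank b j).
    move: a i l b j l'.
    apply: all_tagnat => p l; apply: all_tagnat => q l' pq.
    rewrite -dE !tagnat.sig2K; apply: E; apply: contraNneq pq => ->.
    exact: eqxx.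
  split=> // [a|].
    apply/coefs_dcomp; split; first exact: sym0_mxsub.
      move: a; apply: all_tagnat => p.
      suff -> : block (tagnat.rank (p_:=_)) (tagnat.sig2 p)
          (block (tagnat.rank (p_:=_)) (tagnat.sig1 p) d) =
        block (@tagnat.rank _ M) p c by exact: H1.
      by apply/matrixP => l l'; rewrite !mxE dE mxE.
    exists (block (@tagnat.rank k n_) a c0); first exact: wY.
    by move=> i l j l' ij; rewrite [LHS]mxE dw ?mxE // eq_Tagged.
  exists z0 => // a u b v ab; rewrite -(tagnat.sig2K u) -(tagnat.sig2K v).
  rewrite dw; first exact: Ew.
  by apply: contraNneq ab => /(congr1 tag) /= ->.
have cs : sym0 c by exact: sym0_mxsubI (cast_ordKV h) ds.
have /choice_dep [y yP] a : exists y, coefs (sval (Y a)) y /\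
    forall i l j l', i != j -> d (@r a i l) (@r a j l') = y i j.
  have [_ _ [y Yy Ey]] := (coefs_dcomp _ _ _).1 (H1 a).
  by exists y; split=> // i l j l' ij; rewrite -(Ey i l j l' ij) [RHS]mxE.
have c0s := H0.1; have ys a : sym0 (y a) by exact: (yP a).1.1.
pose rb := @tagnat.rank_bij k n_.
(* The outer coefficients for the composite of [Z] and [Y]: [y a] within block a, and [c0] between
   blocks. *)
pose w := comp_mx (@tagnat.rank k n_) c0 y.
have wb a : block (@tagnat.rank k n_) a w = y a by exact: (block_comp_mx rb y a c0s).
have wo a i b j : a != b ->
    w (@tagnat.Rank k n_ a i) (@tagnat.Rank k n_ b j) = c0 a b.
  exact: (comp_mx_outer rb c0 y (t := Tagged _ i) (t' := Tagged _ j)).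
have dw a i l b j l' : Tagged _ i != Tagged _ j :> {a & 'I_(n_ a)} ->
    d (@r a i l) (@r b j l') = w (tagnat.Rank a i) (tagnat.Rank b j).
  have [ab|ab] := eqVneq a b; last by rewrite wo // => _; exact: E.
  subst b; rewrite eq_Tagged /= => ij; rewrite ((yP a).2 _ _ _ _ ij) -(wb a).
  by rewrite mxE.
split=> // [p|].
  have [_ /(_ (tagnat.sig2 p)) + _] := (coefs_dcomp _ _ _).1 (H1 (tagnat.sig1 p)).
  congr (coefs _ _).
  by apply/matrixP => l l'; rewrite !mxE !rE.
exists w.
  apply/coefs_dcomp; split; first exact: (sym0_comp_mx rb).
    by move=> a; rewrite wb; exact: (yP a).1.
  by exists c0.
move=> p l q l' pq; rewrite dE dw ?tagnat.sig2K //.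
by apply: contraNneq pq => E1; apply/eqP/tagnat.sig_inj; rewrite !tagnat.sigE12.
Qed.

(** A permutation within the blocks acts on each diagonal block separately and preserves the
    constant values between blocks. *)
Lemma dequiv_inner k (n_ : 'I_k -> nat) (Y : DStaeckel R k)
    (X : forall a, DStaeckel R (n_ a)) (s : forall a, 'S_(n_ a)) :
  dcomp Y (fun a => dact (X a) (s a)) = dact (dcomp Y X) (sum_of_perms s).
Proof.
have pE a i : sum_of_perms s (tagnat.Rank a i) = tagnat.Rank a (s a i).
  by rewrite permE /sum_perm_fun /tagnat.sig1 /tagnat.sig2 tagnat.rankK.
have bE a (d : 'M[R]_(\sum_a n_ a)) : block (@tagnat.rank k n_) a
    (mxsub (sum_of_perms s) (sum_of_perms s) d) =
    mxsub (s a) (s a) (block (@tagnat.rank k n_) a d).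
  by apply/matrixP => i j; rewrite !mxE !pE.
apply: DStaeckel_eq => d.
apply: iff_trans (coefs_dcomp _ _ _) (iff_sym _).
apply: iff_trans (coefs_dact _ _ _) _; apply: iff_trans (coefs_dcomp _ _ _) _.
split=> -[ds Xd [c0 Yc0 E]]; split.
- exact: sym0_mxsubI (permKV _) ds.
- by move=> a; apply/coefs_dact; rewrite -bE.
- exists c0 => // a i b j ab.
  by have := E a ((s a)^-1%g i) b ((s b)^-1%g j) ab; rewrite mxE !pE !permKV.
- exact: sym0_mxsub.
- by move=> a; rewrite bE; apply/coefs_dact.
- by exists c0 => // a i b j ab; rewrite mxE !pE E.
Qed.

(** Up to the cast, [block_perm] sends place i of the a-th permuted block to place i of block s a.
    Reindexing thus matches the blocks and applies s to the indices of the outer coefficients. *)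
Lemma dequiv_outer k (n_ : 'I_k -> nat) (Y : DStaeckel R k)
    (X : forall a, DStaeckel R (n_ a)) (s : 'S_k) :
  Tagged (DStaeckel R) (dcomp (dact Y s) X) =
  Tagged (DStaeckel R) (dact (dcomp Y (fun a => X (s a))) (block_perm n_ s)).
Proof.
have h := esym (sum_perm n_ s).
have pE a i : block_perm n_ s (@tagnat.Rank k (fun a => n_ (s a)) a i) =
    cast_ord h (tagnat.Rank (s a) i).
  rewrite permE /block_fun /tagnat.sig1 /tagnat.sig2 tagnat.rankK.
  exact: val_inj.
apply: (DStaeckel_Tagged (h := h)) => c; set d := mxsub (cast_ord h) _ c.
have dE a i b j : mxsub (block_perm n_ s) (block_perm n_ s) c
    (@tagnat.Rank k (fun a => n_ (s a)) a i)
    (@tagnat.Rank k (fun a => n_ (s a)) b j) =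
    d (tagnat.Rank (s a) i) (tagnat.Rank (s b) j).
  by rewrite !mxE !pE.
have bE a : block (@tagnat.rank k (fun a => n_ (s a))) a
    (mxsub (block_perm n_ s) (block_perm n_ s) c) =
    block (@tagnat.rank k n_) (s a) d.
  by apply/matrixP => i j; rewrite mxE dE [RHS]mxE.
apply: iff_trans (coefs_dcomp _ _ _) (iff_sym _).
apply: iff_trans (coefs_dact _ _ _) _; apply: iff_trans (coefs_dcomp _ _ _) _.
split=> -[ds Xd [c0 Yc0 E]]; split.
- apply/sym0_mxsub; apply: sym0_mxsubI (permKV (block_perm n_ s)) ds.
- by move=> a; rewrite -(permKV s a) -bE.
(* The outer coefficients are carried back along s, since block a of [d] is the permuted block
   number s^-1 a. *)
- exists (mxsub (s^-1)%g (s^-1)%g c0).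
    apply/coefs_dact; suff -> : mxsub s s (mxsub (s^-1)%g (s^-1)%g c0) = c0 by [].
    by apply/matrixP => a b; rewrite !mxE !permK.
  suff H a b : a != b -> forall i j, d (tagnat.Rank a i) (tagnat.Rank b j) =
      (mxsub (s^-1)%g (s^-1)%g c0) a b by move=> a i b j ab; exact: H.
  rewrite -(permKV s a) -(permKV s b) (inj_eq perm_inj) => ab i j.
  by rewrite -dE E // mxE !permKV.
- apply/sym0_mxsub; apply: sym0_mxsubI ds.
  exact: (cast_ordKV h).
- by move=> a; rewrite bE.
- exists (mxsub s s c0); first exact/coefs_dact.
  by move=> a i b j ab; rewrite dE E ?mxE // (inj_eq perm_inj).
Qed.
End OperadLaws.

Theorem proposition5 (R : realType) :
  (forall (k n : nat) (n_ : 'I_k -> nat)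
     (e : {a : 'I_k & 'I_(n_ a)} -> 'I_n)
     (V0 : set (tensor_field R k)) (V : forall a, set (tensor_field R (n_ a))),
     bijective e ->
     diag_staeckel V0 -> (forall a, diag_staeckel (V a)) ->
     direct_spaces (iota0 e @` V0) (fun a => iota1 e (a := a) @` V a) /\
     staeckel (staeckel_comp e V0 V))
  /\
  (exists op : operad (DStaeckel R),
     (forall (k : nat) (n_ : 'I_k -> nat) (S0 : DStaeckel R k)
        (S : forall a, DStaeckel R (n_ a)),
        sval (op_comp op S0 S) =
        staeckel_comp (@tagnat.rank k n_) (sval S0) (fun a => sval (S a)))
     /\
     (forall (n : nat) (S : DStaeckel R n) (s : 'S_n),
        sval (op_act op S s) = perm_act s @` sval S)).
Proof.
split=> [k n n_ e V0 V eb dV0 dV|].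
  split; first exact: comp_direct.
  by have [] := comp_staeckel eb dV0 dV.
exists (@Operad (DStaeckel R) (@dcomp R) (@dact R) (@dunit R) (@dact1 R)
  (@dactM R) (@dcomp1r R) (@dcomp1l R) (@dcompA R) (@dequiv_outer R)
  (@dequiv_inner R)).
by split.
Qed.
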